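(* For every $n>0$, $\nu\in[0,1]$ and $p\in\{1,\ldots,n-1\}$, $$e_{p,\nu}(n,1)\leq\nu(1-\nu)(\nu^p+(1-\nu)^p)\sum_{l=p+1}^n(-1)^{l+1-p}q_{l,n}-\lambda_{p,\nu}(n).$$
   Context: $\Delta_n$ is the standard $n$-simplex; $\mathrm{Sd}^d(K)$ is the $d$-th iterated barycentric subdivision of $K$; $f_i(K)$ is the number of $i$-simplices of $K$; $b_i(X)=\dim H_i(X;\mathbb{Z}/2\mathbb{Z})$. $q_{l,n}=\lim_{d\to+\infty}\frac{f_l(\mathrm{Sd}^d(\Delta_n))}{(n+1)!^d}$ (this limit exists). Definition of $e_{p,\nu}(n,1)$. For a simplicial complex $K$ and $\epsilon\in C^0(K;\mathbb{Z}/2\mathbb{Z})$, $V_\epsilon$ is the subcomplex of $\mathrm{Sd}(K)$ which is the union of all closed simplices $[\hat\sigma_0,\ldots,\hat\sigma_q]$ of $\mathrm{Sd}(K)$ ($\hat\sigma_i$ the barycenter of $\sigma_i\in K$, $\sigma_i$ a proper face of $\sigma_{i+1}$) such that $\sigma_0$ is an edge of $K$ on which $\epsilon$ is not constant. For a finite $n$-dimensional $K$, let $\mathbb{E}_{\nu,d}(b_p)$ be the expectation of $b_p(V_\epsilon)$ for $\epsilon\in C^0(\mathrm{Sd}^d(K);\mathbb{Z}/2\mathbb{Z})$ (so $V_\epsilon\subset\mathrm{Sd}^{d+1}(K)$) whose values at the vertices are independent, each being $0$ with probability $\nu$ and $1$ with probability $1-\nu$. Then $e_{p,\nu}(n,1)=\lim_{d\to+\infty}\frac{\mathbb{E}_{\nu,d}(b_p)}{f_n(K)(n+1)!^d}$,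 which exists and does not depend on $K$. Definition of $\lambda_{p,\nu}(n)$. For a finite simplicial complex $L$, $$M_{p,\nu}(L)=(\nu^{p+1}+(1-\nu)^{p+1})\,b_p(L)+\nu(1-\nu)(\nu^p+(1-\nu)^p)\sum_{i=p+1}^{\dim L}(-1)^{i+1-p}(f_i(L)-b_i(L)),$$ the sum being zero if $p\geq\dim L$. For $d>0$, $\mathcal{L}_d^{n,p}$ is the finite set of subcomplexes $L$ of $\mathrm{Sd}^d(\Delta_n)$ containing a family of simplices $\{\sigma_i\in L,\ i\in I\}$ such that (1) every $\tau\in L$ is a face of some $\sigma_i$; (2) $\dim(\sigma_i\cap\sigma_j)<p-1$ for all $i\neq j$ in $I$; (3) $\dim(\sigma_i\cap\mathrm{Sd}^d(\partial\Delta_n))<p-1$ for all $i\in I$ (with $\dim\emptyset=-1$). Set $\lambda^d_{p,\nu}(n)=\frac{1}{(n+1)!^d}\max_{L\in\mathcal{L}_d^{n,p}}M_{p,\nu}(L)$. The sequence $(\lambda^d_{p,\nu}(n))_d$ is non-decreasing and bounded, and $\lambda_{p,\nu}(n)$ is its limit as $d\to+\infty$. *)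

(* Defs.v *)
From HB Require Import structures.
From mathcomp Require Import all_boot all_order all_algebra.
From mathcomp Require Import reals topology normedtype sequences.
From mathcomp Require Import finset.

Set Implicit Arguments.
Unset Strict Implicit.
Unset Printing Implicit Defensive.

Import Order.TTheory GRing.Theory Num.Theory numFieldNormedType.Exports.
Local Open Scope ring_scope.

(* A finite simplicial complex is the set of its nonempty simplices, each given
   by its set of vertices.  Elements x of T with [set x] \notin K are not
   vertices of K. *)
Definition simplicial (T : finType) (K : {set {set T}}) : bool :=
  (set0 \notin K) &&
  [forall s in K, forall t : {set T}, (t != set0) && (t \subset s) ==> (t \in K)].

Definition faces (T : finType) (K : {set {set T}}) (k : nat) : {set {set T}} :=
  [set s in K | #|s| == k].

Definition fvec (T : finType) (K : {set {set T}}) (i : nat) : nat :=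
  #|faces K i.+1|.

(* Dimension plus one; it is 0 for the empty complex. *)
Definition height (T : finType) (K : {set {set T}}) : nat := \max_(s in K) #|s|.

Definition sdim (T : finType) (s : {set T}) : int := #|s|%:Z - 1.

Definition dimc (T : finType) (K : {set {set T}}) : int := (height K)%:Z - 1.

(* The boundary C_k(K; Z/2) -> C_(k-1)(K; Z/2) acting on row vectors.  As set0
   is not in K, the target is 0 for k = 0, so the homology is not reduced. *)
Definition boundary (T : finType) (K : {set {set T}}) (k : nat) :
    'M['F_2]_(#|faces K k.+1|, #|faces K k|) :=
  \matrix_(a, b) ((enum_val b : {set T}) \subset (enum_val a : {set T}))%:R.

(* dim ker - dim im; the subtraction of natural numbers does not truncate, by
   boundary_boundary below. *)
Definition betti (T : finType) (K : {set {set T}}) (i : nat) : nat :=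
  (\rank (kermx (boundary K i)) - \rank (boundary K i.+1))%N.

Lemma boundary_boundary (T : finType) (K : {set {set T}}) (k : nat) :
  simplicial K -> boundary K k.+1 *m boundary K k = 0.
Proof.
move=> /andP[K0 /forall_inP clK]; apply/matrixP => a c; rewrite !mxE.
have [A eA] : exists A, A = enum_val a by exists (enum_val a).
have [C eC] : exists C, C = enum_val c by exists (enum_val c).
have := enum_valP a; have := enum_valP c; rewrite !inE -eA -eC.
move=> /andP[CK /eqP Ck] /andP[AK /eqP Ak].
under eq_bigr => b _ do rewrite !mxE -eA -eC -natrM mulnb.
transitivity
    (\sum_(B in faces K k.+1) ((B \subset A) && (C \subset B))%:R : 'F_2).
  by rewrite [RHS]big_enum_val; apply: eq_bigr => b _.
case: (boolP (C \subset A)) => CA; last first.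
  rewrite big1 // => B _; case: andP => // -[BA CB].
  by rewrite (subset_trans CB BA) in CA.
have cAC : #|A :\: C| = 2%N by rewrite cardsDS // Ak Ck -addn2 addKn.
rewrite -natr_sum -big_mkcondr /= sum1_card.
rewrite (_ : #|_| = #|[set x |: C | x in A :\: C]|).
  rewrite card_in_imset ?cAC; first exact/eqP.
  move=> x y /setDP[_ xC] _ /setP/(_ x); rewrite !inE eqxx /= (negPf xC) orbF.
  by move=> /esym/eqP.
apply: eq_card => B; rewrite [LHS]unfold_in /= inE; apply/idP/imsetP.
  move=> /andP[/andP[BK /eqP Bk] /andP[BA CB]].
  have /eqP/cards1P[x Bx] : #|B :\: C| = 1%N by rewrite cardsDS // Bk Ck subSnn.
  have xBC : x \in B :\: C by rewrite Bx set11.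
  exists x; first by move: xBC; rewrite !inE => /andP[-> /(subsetP BA)].
  rewrite -Bx; apply/setP => y; rewrite !inE.
  by case: (boolP (y \in C)) => [/(subsetP CB) ->|_]; rewrite ?orbF.
move=> [x /setDP[xA xC] ->].
rewrite cardsU1 xC Ck eqxx andbT subUset sub1set xA CA subsetUr !andbT.
have /forallP/(_ (x |: C)) := clK A AK; move/implyP; apply.
by rewrite subUset sub1set xA CA !andbT; apply/set0Pn; exists x; rewrite setU11.
Qed.

(* Barycentric subdivision: its vertices, the barycenters, are represented by
   the simplices of K themselves, and its simplices are the nonempty flags. *)
Definition Sd (T : finType) (K : {set {set T}}) : {set {set {set T}}} :=
  [set c : {set {set T}} | [&& c != set0, c \subset K &
     [forall s in c, forall t in c, (s \subset t) || (t \subset s)]]].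

Fixpoint SdT (T : finType) (d : nat) : finType :=
  if d is d'.+1 then ({set (SdT T d')} : finType) else T.

Fixpoint iterSd (T : finType) (K : {set {set T}}) (d : nat) :
    {set {set (SdT T d)}} :=
  if d is d'.+1 then Sd (iterSd K d') else K.

Definition Delta (n : nat) : {set {set 'I_n.+1}} := [set s | s != set0].

Definition bdDelta (n : nat) : {set {set 'I_n.+1}} :=
  [set s in Delta n | s != setT].

Definition vertex (T : finType) (K : {set {set T}}) : finType :=
  {v : T | [set v] \in K}.

Definition cochain0 (T : finType) (K : {set {set T}}) : finType :=
  {ffun vertex K -> 'F_2}.

Definition nonconst (T : finType) (K : {set {set T}}) (eps : cochain0 K)
    (s : {set T}) : bool :=
  [exists u : vertex K, exists v : vertex K,
     [&& val u \in s, val v \in s & eps u != eps v]].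

(* V_eps consists of the nonempty faces s of the flags c whose least element e
   is an edge on which eps is not constant. *)
Definition Veps (T : finType) (K : {set {set T}}) (eps : cochain0 K) :
    {set {set {set T}}} :=
  [set s : {set {set T}} | (s != set0) &&
     [exists c in Sd K, (s \subset c) &&
        [exists e in c, [&& [forall t in c, e \subset t], #|e| == 2%N &
           nonconst eps e]]]].

Definition cochain_prob (R : realType) (nu : R) (T : finType)
    (K : {set {set T}}) (eps : cochain0 K) : R :=
  \prod_(v : vertex K) (if eps v == 0 then nu else 1 - nu).

Definition expected_betti (R : realType) (nu : R) (p : nat) (T : finType)
    (K : {set {set T}}) : R :=
  \sum_(eps : cochain0 K) cochain_prob nu eps * (betti (Veps eps) p)%:R.

(* The limit e_(p,nu)(n,1) is read off an arbitrary K of dimension n, on which it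
   does not depend. *)
Definition e_ (R : realType) (p : nat) (nu : R) (n : nat) (T : finType)
    (K : {set {set T}}) : R :=
  limn (fun d : nat =>
    expected_betti nu p (iterSd K d) / ((fvec K n)%:R * (n.+1)`!%:R ^+ d)).

Definition q_ (R : realType) (l n : nat) : R :=
  limn (fun d : nat => (fvec (iterSd (Delta n) d) l)%:R / (n.+1)`!%:R ^+ d : R).

Definition M_ (R : realType) (p : nat) (nu : R) (T : finType)
    (L : {set {set T}}) : R :=
  (nu ^+ p.+1 + (1 - nu) ^+ p.+1) * (betti L p)%:R +
  nu * (1 - nu) * (nu ^+ p + (1 - nu) ^+ p) *
    \sum_(p.+1 <= i < height L)
      (-1) ^+ (i.+1 - p) * ((fvec L i)%:R - (betti L i)%:R).

(* The family (sigma_i) is a set S, indexed by itself.  SdT depends only on the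
   vertex type, so the subdivisions of Delta n and of its boundary live in the
   same type, and sigma meets Sd^d(bdDelta n) in the set of its faces lying
   there. *)
Definition packings (n p d : nat) : {set {set {set (SdT 'I_n.+1 d)}}} :=
  [set L : {set {set (SdT 'I_n.+1 d)}} |
    [&& simplicial L, L \subset iterSd (Delta n) d &
     [exists S : {set {set (SdT 'I_n.+1 d)}},
      [&& S \subset L,
       [forall t in L, exists s in S, t \subset s],
       [forall s in S, forall t in S, (s != t) ==> (sdim (s :&: t) < p%:Z - 1)] &
       [forall s in S,
          dimc [set t in iterSd (bdDelta n) d | t \subset s] < p%:Z - 1]]]]].

(* The empty complex belongs to packings n p d, so its value is a legitimate
   starting point for the maximum. *)
Definition lambda_d (R : realType) (p : nat) (nu : R) (n d : nat) : R :=
  (\big[Num.max/M_ p nu (set0 : {set {set (SdT 'I_n.+1 d)}})]_(L in packings n p d)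
     M_ p nu L) / (n.+1)`!%:R ^+ d.

Definition lambda_ (R : realType) (p : nat) (nu : R) (n : nat) : R :=
  limn (fun d : nat => lambda_d p nu n d).

(* Main.v *)
From HB Require Import structures.
Require Import Defs.
From mathcomp Require Import all_boot all_order all_algebra.
From mathcomp Require Import zify ring lra.
From mathcomp Require Import boolp reals topology normedtype sequences.

Set Implicit Arguments.
Unset Strict Implicit.
Unset Printing Implicit Defensive.

Import Order.TTheory GRing.Theory Num.Theory numFieldNormedType.Exports.
Local Open Scope ring_scope.

(** Write [c] for [nu (1 - nu) (nu^p + (1 - nu)^p)], let [X] be a subdivision of
    [K] and let [X_0], [X_1] be its full subcomplexes on the vertices where
    [eps] is 0, resp. 1.

    The hypersurface [V_eps] is the intersection of two subcomplexes of [Sd X],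
    made of the flags of simplices meeting the first, resp. the second color,
    whose union is [Sd X] ([Veps_inter], [Sd_union]).  These two subcomplexes
    retract onto [X_0] and [X_1] ([cbetti_meeting_le]), so by the Mayer-Vietoris
    sequence [b_p(V_eps) <= b_p(X_0) + b_p(X_1) + b_(p+1)(Sd X)].  By the same
    retraction subdividing does not increase Betti numbers ([cbetti_Sd_le]), so
    that the last term stays bounded and is negligible in the limit.

    It remains to bound the expectation of [b_p(X_0) + b_p(X_1)].  Let [r(X)] be
    the rank of the boundary map from the (p+1)-chains to the p-chains of [X].
    Let [W] be a subcomplex of [X] that has no homology in degree [p], nor has
    its intersection with any full subcomplex of [X].  Up to bounded terms,
    linear algebra gives [r(X) - r(W)] simplices of dimension [p] and as many of
    dimension [p + 1], independently of [eps], such that [b_p(X_a)] is at most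
    the number of the former lying in [X_a] minus the number of the latter
    lying in [X_a] ([induced_betti_bound]).  A p-simplex lies in [X_0] with
    probability [nu^(p+1)] and a (p+1)-simplex with probability [nu^(p+2)];
    adding both colors, the expectation is at most [c (r(X) - r(W))], up to
    bounded terms ([expected_betti_le]).

    For [W] take a copy of a packing [L] in each simplex of dimension [n] of a
    coarser subdivision ([packed_copies]).  The simplices of a packing share no
    face with [p] vertices, so the chains of [W] in high degrees split into
    those of single simplices and [W] has no homology in degrees at least [p],
    nor has its intersection with a full subcomplex ([packed_acyclic]).  Hence
    [M(L) = c r(L)], and [r(W)] is [r(L)] times the number of copies, because
    [r] is an alternating sum of face numbers and Betti numbers
    ([rank_alternating]).  The same formula for [r(X)] produces the face numbers
    whose normalised limits are the [q_(l,n)].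

    These limits exist because face numbers obey a triangular linear recursion
    under subdivision ([fvec_Sd_sum], [fvec_limit]).  Dividing by the number of
    simplices of dimension [n] gives
    [e <= c sum_l (-1)^(l+1-p) q_(l,n) - M(L) / (n+1)!^d] for every packing [L],
    and the theorem by taking the maximum over [L] and the limit over [d]. *)

(** * Chains over a field of characteristic two *)

Section Chains.
Variable (F : fieldType).
Hypothesis char2 : 2%N \in [pchar F].

Local Notation chain T := {ffun {set T} -> F^o}.

Lemma chain_addrr (T : finType) (x : chain T) : x + x = 0.
Proof. by apply/ffunP => s; rewrite !ffunE; apply: addrr_pchar2. Qed.

Definition delta (T : finType) (s : {set T}) : chain T :=
  [ffun t : {set T} => (t == s)%:R].

Lemma scaleffE (T : finType) (x : chain T) k t : (k *: x) t = k * x t.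
Proof. by rewrite ffunE. Qed.

Lemma chain_sum (T : finType) (x : chain T) : x = \sum_s x s *: delta s.
Proof.
apply/ffunP => t; rewrite sum_ffunE (bigD1 t) //= big1 ?addr0.
  by rewrite scaleffE ffunE eqxx mulr1.
by move=> s /negPf st; rewrite scaleffE ffunE eq_sym st mulr0.
Qed.

Section LinearExtension.
Variables (A B : finType) (f : {set A} -> chain B).
Definition linext_fun (x : chain A) : chain B := \sum_s x s *: f s.
Lemma linext_fun_linear : linear linext_fun.
Proof.
move=> k x y; rewrite /linext_fun scaler_sumr -big_split /=;
  apply: eq_bigr => s _.
by rewrite !ffunE scalerDl scalerA.
Qed.
HB.instance Definition _ := GRing.isLinear.Build _ _ _ _ _ linext_fun_linear.
(** The operators on chains are locked: they are only ever computed through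
    their values on coefficients or on single simplices. *)
Definition linext : 'Hom(chain A, chain B) := locked (linfun linext_fun).
Lemma linextE x : linext x = \sum_s x s *: f s.
Proof. by rewrite -[X in fun_of_lfun X]lock lfunE. Qed.
Lemma linext_delta s : linext (delta s) = f s.
Proof.
rewrite linextE (bigD1 s) //= big1 ?addr0; first by rewrite ffunE eqxx scale1r.
by move=> t /negPf ts; rewrite ffunE ts scale0r.
Qed.
End LinearExtension.

Lemma hom_eq_delta (A B : finType) (f g : 'Hom(chain A, chain B)) :
  (forall s, f (delta s) = g (delta s)) -> forall x, f x = g x.
Proof.
move=> fg x; rewrite [x]chain_sum !linear_sum; apply: eq_bigr => s _.
by rewrite !linearZ /= fg.
Qed.

Section Operators.
Variable T : finType.
Implicit Types (x : chain T) (X Y : {set {set T}}) (v : T) (s t : {set T}).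

(** The augmented boundary: the empty set counts as a simplex, so that a vertex
    has boundary [delta set0].  This changes no homology group of positive
    degree, and the cone formula below then has no exception. *)
Definition bd_fun x : chain T :=
  [ffun t : {set T} => \sum_(a | a \notin t) x (a |: t)].
Lemma bd_fun_linear : linear bd_fun.
Proof.
move=> k x y; apply/ffunP => t; rewrite !ffunE scaler_sumr -big_split /=.
by apply: eq_bigr => a _; rewrite !ffunE.
Qed.
HB.instance Definition _ := GRing.isLinear.Build _ _ _ _ _ bd_fun_linear.
Definition bd : 'End(chain T) := locked (linfun bd_fun).
Lemma bdE x t : bd x t = \sum_(a | a \notin t) x (a |: t).
Proof. by rewrite -[X in fun_of_lfun X]lock lfunE /= ffunE. Qed.

Definition cone_fun v x : chain T :=
  [ffun t : {set T} => if v \in t then x (t :\ v) else 0].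
Lemma cone_fun_linear v : linear (cone_fun v).
Proof. by move=> k x y; apply/ffunP => t; rewrite !ffunE; case: ifP;
  rewrite ?scaler0 ?addr0. Qed.
HB.instance Definition _ v := GRing.isLinear.Build _ _ _ _ _
  (cone_fun_linear v).
Definition cone v : 'End(chain T) := locked (linfun (cone_fun v)).
Lemma coneE v x t : cone v x t = if v \in t then x (t :\ v) else 0.
Proof. by rewrite -[X in fun_of_lfun X]lock lfunE /= ffunE. Qed.

Definition proj_fun X x : chain T :=
  [ffun t : {set T} => if t \in X then x t else 0].
Lemma proj_fun_linear X : linear (proj_fun X).
Proof. by move=> k x y; apply/ffunP => t; rewrite !ffunE; case: ifP;
  rewrite ?scaler0 ?addr0. Qed.
HB.instance Definition _ X := GRing.isLinear.Build _ _ _ _ _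
  (proj_fun_linear X).
Definition proj X : 'End(chain T) := locked (linfun (proj_fun X)).
Lemma projE X x t : proj X x t = if t \in X then x t else 0.
Proof. by rewrite -[X in fun_of_lfun X]lock lfunE /= ffunE. Qed.

(** The cone is a contraction of all chains, the augmented complex of a full
    simplex being acyclic.  When [v] is already in a simplex its cone is 0, and
    the simplex itself is the cone of its facet opposite to [v]. *)
Lemma bd_cone v x : bd (cone v x) = x + cone v (bd x).
Proof.
suff E : bd (cone v x) + cone v (bd x) = x.
  by rewrite -{2}E -addrA chain_addrr addr0.
apply/ffunP => t; rewrite !ffunE bdE coneE bdE.
case: ifP => vt; last first.
  rewrite addr0 (bigD1 v) ?vt //= coneE setU11 setU1K ?vt // big1 ?addr0 //.
  by move=> a /andP[_ av]; rewrite coneE in_setU1 vt orbF eq_sym (negPf av).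
rewrite [X in _ + X](bigD1 v) /=; last by rewrite !inE eqxx.
rewrite setD1K // addrCA.
set S1 := \sum_(i | _) _; set S2 := \sum_(i | _) _.
suff -> : S2 = S1 by rewrite (addrr_pchar2 char2) addr0.
apply: eq_big => [a|a ha].
  rewrite !inE; case: (eqVneq a v) => [->|] //=; last by rewrite andbT.
  by rewrite vt.
rewrite coneE in_setU1 vt orbT; congr (x _); apply/setP => b; rewrite !inE.
by case: (eqVneq b v) => [->|] //=; rewrite orbF eq_sym; move: ha;
  rewrite !inE => /andP[_ /negPf].
Qed.

Lemma cone_delta v s : v \notin s -> cone v (delta s) = delta (v |: s).
Proof.
move=> vs; apply/ffunP => t; rewrite coneE !ffunE.
case: ifP => vt.
  congr (_%:R); congr nat_of_bool; apply/eqP/eqP.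
    by move=> <-; rewrite setD1K.
  by move=> ->; rewrite setU1K.
by case: eqP => // E; rewrite E setU11 in vt.
Qed.

Lemma bd_delta0 : bd (delta set0) = 0.
Proof.
apply/ffunP => t; rewrite bdE !ffunE big1 // => a _; rewrite ffunE.
by case: eqP => // /setP/(_ a); rewrite !inE eqxx.
Qed.

(** By induction on [s]: a nonempty simplex is a cone over its facet opposite to
    one of its vertices, and the cone formula reduces its double boundary to
    the cone of the double boundary of that facet. *)
Lemma bd_bd x : bd (bd x) = 0.
Proof.
suff H s : (bd \o bd)%VF (delta s) = (0 : 'End(chain T)) (delta s).
  by have := hom_eq_delta H x; rewrite comp_lfunE zero_lfunE.
rewrite comp_lfunE zero_lfunE.
have [m] := ubnP #|s|; elim: m s => // m IH s; rewrite ltnS => sm.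
have [->|[v vs]] := set_0Vmem s; first by rewrite bd_delta0 linear0.
rewrite -(setD1K vs) -cone_delta ?setD11 // bd_cone linearD /= bd_cone IH.
  by rewrite linear0 addr0 chain_addrr.
by apply: leq_trans sm; rewrite [#|s|](cardsD1 v) vs.
Qed.

Definition chains X : {vspace chain T} := limg (proj X).

Lemma chainsP X x : reflect (forall s, s \notin X -> x s = 0) (x \in chains X).
Proof.
apply: (iffP idP).
  by move=> /memv_imgP[y _ ->] s /negPf sX; rewrite projE sX.
move=> H; have -> : x = proj X x.
  by apply/ffunP => s; rewrite projE; case: ifP => // /negbT/H ->.
by apply: memv_img; apply: memvf.
Qed.

Lemma proj_chains X x : proj X x \in chains X.
Proof. exact/memv_img/memvf. Qed.

Lemma proj_id X x : x \in chains X -> proj X x = x.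
Proof. by move/chainsP => H; apply/ffunP => s; rewrite projE;
  case: ifP => // /negbT/H ->. Qed.

Lemma delta_chains X s : (delta s \in chains X) = (s \in X).
Proof.
apply/chainsP/idP => [H|sX t tX].
  apply/negPn/negP => /H; rewrite ffunE eqxx => /eqP.
  by rewrite oner_eq0.
by rewrite ffunE; case: eqP => // ts; rewrite ts sX in tX.
Qed.

Lemma chainsS X Y : X \subset Y -> (chains X <= chains Y)%VS.
Proof.
move=> /subsetP XY; apply/subvP => x /chainsP H; apply/chainsP => s sY;
  apply: H.
by apply: contra sY => /XY.
Qed.

Lemma chainsI X Y : (chains X :&: chains Y)%VS = chains (X :&: Y).
Proof.
apply/vspaceP => x; apply/memv_capP/chainsP => [[/chainsP HX /chainsP HY] s|H].
  by rewrite inE negb_and => /orP[/HX|/HY].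
by split; apply/chainsP => s sX; apply: H; rewrite inE (negPf sX) ?andbF.
Qed.

Lemma chains_sum X x : x \in chains X -> x = \sum_(s in X) x s *: delta s.
Proof.
move=> /chainsP H; rewrite {1}[x]chain_sum [RHS]big_mkcond /=;
  apply: eq_bigr => s _.
by case: ifP => // /negbT/H ->; rewrite scale0r.
Qed.

Lemma chains_span X : chains X = <<[seq delta s | s <- enum X]>>%VS.
Proof.
apply/eqP; rewrite eqEsubv; apply/andP; split; last first.
  apply/span_subvP => x /mapP[s]; rewrite mem_enum => sX ->.
  by rewrite delta_chains.
apply/subvP => x /chains_sum ->; apply: memv_suml => s sX.
by apply/memvZ/memv_span/map_f; rewrite mem_enum.
Qed.

Lemma limg_chains (V : vectType F) (f : 'Hom(chain T, V)) X :
  (f @: chains X)%VS = <<[seq f (delta s) | s <- enum X]>>%VS.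
Proof. by rewrite chains_span limg_span -map_comp. Qed.

Lemma dim_chains X : \dim (chains X) = #|X|.
Proof.
rewrite chains_span.
suff : free [seq delta s | s <- enum X].
  by move/eqP=> ->; rewrite size_map -cardE.
have -> : [seq delta s | s <- enum X] = map_tuple (@delta T) (enum_tuple X) by
  [].
apply/freeP => k /= E i.
have /ffunP/(_ (nth set0 (enum X) i)) := E.
have sz (j : 'I_#|X|) : (j < size (enum X))%N by rewrite -cardE.
rewrite sum_ffunE ffunE (bigD1 i) //= big1.
  by rewrite addr0 scaleffE (nth_map set0) // ffunE eqxx mulr1.
move=> j ji; rewrite scaleffE (nth_map set0) // ffunE nth_uniq ?enum_uniq //.
by rewrite (inj_eq val_inj) eq_sym (negPf ji) mulr0.
Qed.
End Operators.
End Chains.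

(** * Betti numbers as dimensions of spaces of chains *)

Section Homology.
Variable (F : fieldType).
Hypothesis char2 : 2%N \in [pchar F].
Local Notation chain T := {ffun {set T} -> F^o}.
Local Notation delta := (@delta F _).
Local Notation bd := (bd F _).
Local Notation chains := (@chains F _).

Section OneComplex.
Variable T : finType.
Implicit Types (x : chain T) (X Y : {set {set T}}) (v : T) (s t : {set T}).

Lemma bd_delta s t :
  bd (delta s) t = ((t \subset s) && (#|s| == #|t|.+1))%:R.
Proof.
rewrite bdE; case: andP => [[ts /eqP sc]|H].
  have /eqP/cards1P[a Ea] : #|s :\: t| = 1%N by rewrite cardsDS // sc subSnn.
  have /setDP[aS at_] : a \in s :\: t by rewrite Ea set11.
  rewrite (bigD1 a) //= ffunE big1 ?addr0.
    suff -> : a |: t = s by rewrite eqxx.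
    by rewrite -Ea -[RHS](setID s t) setUC (setIidPr ts).
  move=> b /andP[bt ba]; rewrite ffunE; case: eqP => // E.
  have : b \in s :\: t by rewrite !inE bt -E setU11.
  by rewrite Ea inE (negPf ba).
rewrite big1 // => a at_; rewrite ffunE; case: eqP => // E; case: H.
by rewrite -E cardsU1 at_ subsetUr.
Qed.

Lemma bd_chains X Y : (forall s a, s \in Y -> a \in s -> s :\ a \in X) ->
  (bd @: chains Y <= chains X)%VS.
Proof.
move=> H; rewrite limg_chains; apply/span_subvP => y /mapP[s].
rewrite mem_enum => sY ->; apply/chainsP => t tX; rewrite bd_delta.
case: andP => // -[ts /eqP sc]; case/negP: tX.
have /eqP/cards1P[a Ea] : #|s :\: t| = 1%N by rewrite cardsDS // sc subSnn.
have /setDP[aS at_] : a \in s :\: t by rewrite Ea set11.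
have -> : t = s :\ a.
  by rewrite -Ea setDDr setDv set0U; apply/esym/setIidPr.
exact: H.
Qed.

(** Chains are graded by the number [k] of vertices of their simplices, so that
    [cbetti k] is the Betti number in degree [k - 1]. *)
Definition cycles k X : {vspace chain T} := (chains (faces X k) :&: lker bd)%VS.
Definition boundaries k X : {vspace chain T} :=
  (bd @: chains (faces X k.+1))%VS.
Definition cbetti k X : nat := (\dim (cycles k X) - \dim (boundaries k X))%N.

Definition closed_at k X :=
  forall s a, s \in faces X k.+1 -> a \in s -> s :\ a \in X.

Lemma simplicial_closed k X : simplicial X -> (0 < k)%N -> closed_at k X.
Proof.
move=> /andP[X0 /forall_inP clX] k0 s a; rewrite inE => /andP[sX /eqP sk] aS.
have /forallP/(_ (s :\ a)) := clX s sX; move/implyP; apply.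
rewrite subD1set andbT -card_gt0.
by move: sk; rewrite (cardsD1 a) aS add1n => -[->].
Qed.

Lemma closed_faces k X : closed_at k X ->
  (forall s a, s \in faces X k.+1 -> a \in s -> s :\ a \in faces X k).
Proof.
move=> H s a sX aS; rewrite inE H //=.
by move: sX; rewrite inE (cardsD1 a) aS add1n eqSS => /andP[_ ->].
Qed.

Lemma boundaries_sub k X : closed_at k X -> (boundaries k X <= cycles k X)%VS.
Proof.
move=> H; rewrite subv_cap; apply/andP; split.
  exact/bd_chains/closed_faces.
apply/subvP => y /memv_imgP[x _ ->]; rewrite memv_ker bd_bd //.
Qed.

Lemma dim_cycles k X : (\dim (cycles k.+1 X) + \dim (boundaries k X))%N =
  #|faces X k.+1|.
Proof. by rewrite /cycles /boundaries limg_ker_dim dim_chains. Qed.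
End OneComplex.

Section Rank.
(** Replacing [M] by a basis of its rows leaves the image unchanged and makes
    the map injective. *)
Lemma rank_limg m n (M : 'M[F]_(m, n)) :
  \dim (limg (linfun (mulmxr M : 'rV_m -> 'rV_n))) = \rank M.
Proof.
have -> : limg (linfun (mulmxr M : 'rV_m -> 'rV_n)) =
          limg (linfun (mulmxr (row_base M) : 'rV_(\rank M) -> 'rV_n)).
  apply/vspaceP => y; apply/memv_imgP/memv_imgP => -[u _];
    rewrite lfunE /= => ->.
    have : (u *m M <= row_base M)%MS by rewrite eq_row_base submxMl.
    by case/submxP => w ->; exists w; rewrite ?memvf // lfunE.
  have : (u *m row_base M <= M)%MS by rewrite -(eq_row_base M) submxMl.
  by case/submxP => w ->; exists w; rewrite ?memvf // lfunE.
rewrite limg_dim_eq; first by rewrite dimvf dim_matrix [LHS]mul1n.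
apply/eqP; rewrite capfv; apply/lker0P => u v; rewrite !lfunE /=.
exact/row_free_inj/row_base_free.
Qed.

Variable T : finType.
Variable X : {set {set T}}.
Variable k : nat.
(** Row vectors indexed by an enumeration of the faces, as in the boundary
    matrices, read as chains. *)
Definition row_chain_fun (u : 'rV[F]_#|faces X k|) : chain T :=
  \sum_b u 0 b *: delta (enum_val b).
Lemma row_chain_linear : linear row_chain_fun.
Proof.
move=> c u v; rewrite /row_chain_fun scaler_sumr -big_split /=.
by apply: eq_bigr => b _; rewrite !mxE scalerDl scalerA.
Qed.
HB.instance Definition _ := GRing.isLinear.Build _ _ _ _ _ row_chain_linear.
Definition row_chain : 'Hom('rV[F]_#|faces X k|, chain T) := linfun
  row_chain_fun.
Lemma row_chainE u : row_chain u = \sum_b u 0 b *: delta (enum_val b).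
Proof. by rewrite lfunE. Qed.

Lemma row_chain_coef u b : row_chain u (enum_val b) = u 0 b.
Proof.
rewrite row_chainE sum_ffunE (bigD1 b) //= big1 ?addr0.
  by rewrite scaleffE ffunE eqxx mulr1.
move=> c cb; rewrite scaleffE ffunE (inj_eq enum_val_inj) eq_sym (negPf cb).
by rewrite mulr0.
Qed.

Lemma row_chain_inj : lker row_chain = 0%VS.
Proof.
apply/eqP/lker0P => u v E; apply/rowP => b.
by rewrite -!row_chain_coef E.
Qed.

Lemma row_chain_img : limg row_chain = chains (faces X k).
Proof.
apply/eqP; rewrite eqEsubv; apply/andP; split; apply/subvP => x.
  move=> /memv_imgP[u _ ->]; rewrite row_chainE; apply: memv_suml => b _.
  by apply: memvZ; rewrite delta_chains enum_valP.
move=> /chains_sum E; apply/memv_imgP; exists (\row_b x (enum_val b));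
  first exact: memvf.
rewrite row_chainE {1}E big_enum_val; apply: eq_bigr => b _.
by rewrite mxE.
Qed.
End Rank.

Lemma rank_incidence (T : finType) (X : {set {set T}}) k : closed_at k X ->
  \rank (\matrix_(a < #|faces X k.+1|, b < #|faces X k|)
     ((enum_val b : {set T}) \subset (enum_val a : {set T}))%:R
       : 'M[F]_(_, _)) =
  \dim (boundaries k X).
Proof.
move=> cX; set M := (X in \rank X).
rewrite -rank_limg /boundaries -row_chain_img -limg_comp.
have -> : (bd \o row_chain X k.+1 = row_chain X k \o linfun (mulmxr M))%VF.
  apply/lfunP => u; rewrite !comp_lfunE !row_chainE linear_sum /=.
  have -> : linfun (mulmxr M) u = u *m M by rewrite lfunE.
  under [RHS]eq_bigr => b _ do rewrite mxE scaler_suml.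
  rewrite exchange_big /=; apply: eq_bigr => a _.
  under eq_bigr => b _ do rewrite -scalerA.
  rewrite -scaler_sumr linearZ /=; congr (_ *: _).
  have : bd (delta (enum_val a)) \in chains (faces X k).
    apply: (subvP (bd_chains (closed_faces cX))).
    by apply: memv_img; rewrite delta_chains enum_valP.
  move/chains_sum => ->; rewrite big_enum_val; apply: eq_bigr => b _.
  rewrite mxE bd_delta; have := enum_valP a; have := enum_valP b.
  by rewrite !inE => /andP[_ /eqP ->] /andP[_ ->]; rewrite andbT.
rewrite limg_comp [RHS]limg_dim_eq // row_chain_inj; exact: capv0.
Qed.
End Homology.

Lemma char2_F2 : 2%N \in [pchar 'F_2].
Proof. by rewrite pchar_Fp. Qed.

Lemma rank_boundary (T : finType) (K : {set {set T}}) k :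
  simplicial K -> (0 < k)%N ->
  \rank (boundary K k) = \dim (boundaries 'F_2 k K).
Proof. by move=> sK k0; rewrite -rank_incidence //;
  apply: simplicial_closed. Qed.

Lemma betti_cbetti (T : finType) (K : {set {set T}}) i :
  simplicial K -> (0 < i)%N -> betti K i = cbetti 'F_2 i.+1 K.
Proof.
move=> sK i0; rewrite /betti /cbetti mxrank_ker !rank_boundary //.
by rewrite -(dim_cycles 'F_2 i K) addnK.
Qed.

(** * Comparing homology groups *)

Section DimLemmas.
Variables (F : fieldType) (vT wT : vectType F).

(** The dimension count for a map of quotients Z / B -> Z' / B' that is
    injective; the quotients themselves are never formed. *)
Lemma dim_quotient_inj (f : 'Hom(vT, wT)) (Z B : {vspace vT})
  (Z' B' : {vspace wT}) :
  (f @: Z <= Z')%VS -> (B' <= Z')%VS ->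
  (forall z, z \in Z -> f z \in B' -> z \in B) ->
  (\dim Z + \dim B' <= \dim Z' + \dim B)%N.
Proof.
move=> fZ BZ H.
have s1 : (f @: Z + B' <= Z')%VS by rewrite subv_add fZ.
have s2 : (Z :&: f @^-1: B' <= B)%VS.
  by apply/subvP => z /memv_capP[zZ]; rewrite -memv_preim => /(H _ zZ).
have := dimvS s1; have := dimvS s2; have := dimv_sum_cap (f @: Z)%VS B'.
have := limg_ker_dim f Z; have := limg_ker_dim f (Z :&: f @^-1: B')%VS.
have -> : (Z :&: f @^-1: B' :&: lker f = Z :&: lker f)%VS.
  rewrite -capvA; congr (_ :&: _)%VS; apply/capv_idPr/subvP => z.
  by rewrite memv_ker -memv_preim => /eqP ->; rewrite mem0v.
have : (f @: Z :&: B' <= f @: (Z :&: f @^-1: B'))%VS.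
  apply/subvP => y /memv_capP[/memv_imgP[z zZ ->] fzB]; apply: memv_img.
  by rewrite memv_cap zZ -memv_preim.
move/dimvS; lia.
Qed.

(** The dimension count for a map of quotients Z / B -> Z' / B' that is
    surjective. *)
Lemma dim_quotient_surj (f : 'Hom(vT, wT)) (Z B : {vspace vT})
  (Z' B' : {vspace wT}) :
  (Z' <= f @: Z + B')%VS -> (B <= Z)%VS -> (f @: B <= B')%VS ->
  (\dim Z' + \dim B <= \dim Z + \dim B')%N.
Proof.
move=> s1 BZ fB.
have E : (f @: Z + B' = f @: (Z :\: B) + B')%VS.
  rewrite -{1}(addv_diff_cap Z B) (capv_idPr BZ) limgD -addvA.
  by congr (_ + _)%VS; apply/addv_idPr.
move: s1; rewrite E => /dimvS s1.
have := dimv_sum_cap (f @: (Z :\: B))%VS B'.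
have := dimv_cap_compl Z B; rewrite (capv_idPr BZ).
have := limg_ker_dim f (Z :\: B)%VS; lia.
Qed.
End DimLemmas.

Section SubcomplexHomology.
Variable (F : fieldType).
Local Notation chain T := {ffun {set T} -> F^o}.
Local Notation delta := (@delta F _).
Local Notation bd := (bd F _).
Local Notation chains := (@chains F _).
Local Notation linext := (@linext F _ _).
Local Notation cone := (@cone F _).

Lemma cyclesP (T : finType) k (X : {set {set T}}) (z : chain T) :
  reflect (z \in chains (faces X k) /\ bd z = 0) (z \in cycles F k X).
Proof. by apply: (iffP memv_capP); rewrite memv_ker => -[? /eqP]. Qed.

Lemma facesS (T : finType) (X Y : {set {set T}}) k :
  X \subset Y -> faces X k \subset faces Y k.
Proof. by move/subsetP=> XY; apply/subsetP => s;
  rewrite !inE => /andP[/XY ->]. Qed.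

Lemma facesI (T : finType) (X Y : {set {set T}}) k :
  faces (X :&: Y) k = faces X k :&: faces Y k.
Proof. by apply/setP => s; rewrite !inE; case: (_ == _);
  rewrite ?andbT ?andbF. Qed.

Lemma cyclesS (T : finType) k (X Y : {set {set T}}) :
  X \subset Y -> (cycles F k X <= cycles F k Y)%VS.
Proof. by move=> XY; apply: capvS => //; apply/chainsS/facesS. Qed.

Lemma boundariesS (T : finType) k (X Y : {set {set T}}) :
  X \subset Y -> (boundaries F k X <= boundaries F k Y)%VS.
Proof. by move=> XY; apply/limgS/chainsS/facesS. Qed.

Lemma simplicialU (T : finType) (X Y : {set {set T}}) :
  simplicial X -> simplicial Y -> simplicial (X :|: Y).
Proof.
move=> /andP[X0 /forall_inP cX] /andP[Y0 /forall_inP cY]; apply/andP; split.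
  by rewrite inE negb_or X0.
apply/forall_inP => s; rewrite inE => /orP[/cX|/cY] /forallP H;
  apply/forallP => t; apply/implyP => /(implyP (H t)); rewrite inE => -> //.
by rewrite orbT.
Qed.

Lemma simplicialI (T : finType) (X Y : {set {set T}}) :
  simplicial X -> simplicial Y -> simplicial (X :&: Y).
Proof.
move=> /andP[X0 /forall_inP cX] /andP[Y0 /forall_inP cY]; apply/andP; split.
  by rewrite inE negb_and X0.
apply/forall_inP => s; rewrite inE => /andP[/cX /forallP HX /cY /forallP HY].
apply/forallP => t; apply/implyP => H.
by rewrite inE (implyP (HX t) H) (implyP (HY t) H).
Qed.

(** Maps built by the method of acyclic carriers: the value on a simplex [s] is
    the cone, with apex [apex s], of what is needed to correct the values
    already chosen on its facets.  With [G = 0] this yields chain maps, with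
    [G = id + m] homotopies between the identity and [m].  The recursion is on
    the number of vertices, which is the argument [m] of [carr]. *)
Section Carrier.
Variables (A B : finType).
Variables (F0 : chain B) (apex : {set A} -> B) (G : {set A} -> chain B).

Fixpoint carr m (s : {set A}) : chain B :=
  if m is m'.+1 then cone (apex s) (G s + \sum_(x in s) carr m' (s :\ x)) else
    F0.
Definition carrier (s : {set A}) := carr #|s| s.

Lemma carrier0 : carrier set0 = F0.
Proof. by rewrite /carrier cards0. Qed.

Lemma bd_delta_sum (s : {set A}) : bd (delta s) = \sum_(x in s) delta (s :\ x).
Proof.
apply/ffunP => t; rewrite bdE sum_ffunE big_mkcond [RHS]big_mkcond /=.
apply: eq_bigr => x _; case: ifP => xt; case: ifP => xs; rewrite ?ffunE //.
- congr (_%:R); congr nat_of_bool; apply/eqP/eqP => [<-|->].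
    by rewrite setU1K.
  by rewrite setD1K.
- by case: eqP => // E; rewrite -E setU11 in xs.
by case: eqP => // E; rewrite E setD11 in xt.
Qed.

Lemma carrierE s : s != set0 ->
  carrier s = cone (apex s) (G s + linext carrier (bd (delta s))).
Proof.
rewrite -card_gt0 /carrier; move sm: #|s| => n; case: n sm => // m sm _ /=.
congr (cone _ (_ + _)); rewrite bd_delta_sum linear_sum /=;
  apply: eq_bigr => x xs.
by rewrite linext_delta; move: sm; rewrite (cardsD1 x s) xs add1n => -[->].
Qed.

Lemma cone_chains v (Y Y' : {set {set B}}) x : x \in chains Y ->
  (forall t, t \in Y -> v \notin t -> v |: t \in Y') -> cone v x \in chains Y'.
Proof.
move=> /chainsP H YY'; apply/chainsP => t tY'; rewrite coneE;
  case: ifP => // vt.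
by apply: H; apply: contra tY' => /YY'; rewrite setD11 setD1K // => /(_ isT).
Qed.

Lemma linext_chains (f : {set A} -> chain B) Y x (W : {vspace chain B}) : x \in
  chains Y ->
  (forall s, s \in Y -> f s \in W) -> linext f x \in W.
Proof.
move=> xY H; rewrite (chains_sum xY) linear_sum; apply: memv_suml => s sY.
by rewrite linearZ memvZ //= linext_delta H.
Qed.

(** If each [Q s] is stable under adding the apex of [s], all the cones stay in
    it. *)
Lemma carrier_supp (X : {set {set A}}) (Q : {set A} -> {set {set B}}) :
  (forall s x, s \in X -> x \in s -> s :\ x \in X) ->
  (forall s x, s \in X -> x \in s -> Q (s :\ x) \subset Q s) ->
  F0 \in chains (Q set0) ->
  (forall s, s \in X -> s != set0 -> G s \in chains (Q s)) ->
  (forall s t, s \in X -> s != set0 -> t \in Q s -> apex s |: t \in Q s) ->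
  forall s, s \in X -> carrier s \in chains (Q s).
Proof.
move=> cX QS H0 HG HQ s; have [m] := ubnP #|s|; elim: m s => // m IH s sm sX.
have [->|s0] := eqVneq s set0; first by rewrite carrier0.
rewrite carrierE //; apply: (cone_chains (Y := Q s)) => [|t tQ _];
  last exact: HQ.
apply: memvD; first exact: HG.
rewrite bd_delta_sum linear_sum; apply: memv_suml => x xs /=;
  rewrite linext_delta.
apply: (subvP (chainsS _ (QS s x sX xs))); apply: IH; last exact: cX.
by move: sm; rewrite (cardsD1 x s) xs; lia.
Qed.

Lemma carrier_size e : F0 \in chains [set t : {set B} | #|t| == e] ->
  (forall s, G s \in chains [set t : {set B} | #|t|.+1 == (#|s| + e)%N]) ->
  forall s, carrier s \in chains [set t : {set B} | #|t| == (#|s| + e)%N].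
Proof.
move=> H0 HG s; have [m] := ubnP #|s|; elim: m s => // m IH s sm.
have [->|s0] := eqVneq s set0; first by rewrite carrier0 cards0.
rewrite carrierE //; apply: (cone_chains
  (Y := [set t : {set B} | #|t|.+1 == (#|s| + e)%N])).
  apply: memvD; first exact: HG.
  rewrite bd_delta_sum linear_sum; apply: memv_suml => x xs /=;
    rewrite linext_delta.
  have E : #|s| = #|s :\ x|.+1 by rewrite (cardsD1 x s) xs.
  rewrite E addSn; under eq_finset => t do rewrite eqSS.
  by apply: IH; rewrite -ltnS -E.
by move=> t; rewrite !inE => /eqP tE vt; rewrite cardsU1 vt -tE.
Qed.
End Carrier.

Section CharTwo.
Hypothesis char2 : 2%N \in [pchar F].

(** The part of the Mayer-Vietoris sequence around the homology of the
    intersection: a class of [X :&: Y] that dies in [X] and in [Y] comes from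
    the homology of the union by the connecting map.  The kernels of the maps
    to the homology of [X] and of [Y] are imposed one after the other. *)
Lemma mayer_vietoris_cbetti (T : finType) (X Y : {set {set T}}) k :
  simplicial X -> simplicial Y -> (0 < k)%N ->
  (cbetti F k (X :&: Y) <=
    cbetti F k.+1 (X :|: Y) + cbetti F k X + cbetti F k Y)%N.
Proof.
move=> sX sY k0.
have BZ (Z : {set {set T}}) j : simplicial Z -> (0 < j)%N ->
  (boundaries F j Z <= cycles F j Z)%VS.
  by move=> sZ j0; apply: boundaries_sub => //; apply: simplicial_closed.
set V := X :&: Y; set S := X :|: Y.
set Y0 := (cycles F k V :&: boundaries F k X)%VS;
  set Y1 := (Y0 :&: boundaries F k Y)%VS.
have sI : V \subset X by apply: subsetIl.
have sJ : V \subset Y by apply: subsetIr.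
have h1 : (\dim (cycles F k V) + \dim (boundaries F k X) <=
  \dim (cycles F k X) + \dim Y0)%N.
  apply: (dim_quotient_inj (f := \1%VF)); rewrite ?lim1g ?cyclesS ?BZ //.
  by move=> z zZ; rewrite id_lfunE => zB; apply/memv_capP.
have h2 : (\dim Y0 + \dim (boundaries F k Y) <=
  \dim (cycles F k Y) + \dim Y1)%N.
  apply: (dim_quotient_inj (f := \1%VF)); rewrite ?lim1g ?BZ //.
    by apply: subv_trans (capvSl _ _) _; apply: cyclesS.
  by move=> z zZ; rewrite id_lfunE => zB; apply/memv_capP.
have pV (W : {set {set T}}) j x : x \in chains (faces W j) ->
    proj F X x \in chains (faces (X :&: W) j).
  move=> /chainsP H; apply/chainsP => s; rewrite projE; case: ifP => // sX' sn.
  by apply: H; apply: contra sn; rewrite facesI !inE sX' => /andP[-> ->].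
have h3 : (\dim Y1 + \dim (boundaries F k.+1 S) <=
  \dim (cycles F k.+1 S) + \dim (boundaries F k V))%N.
  (* the connecting map: the boundary of the part of the cycle lying in [X] *)
  apply: (dim_quotient_surj (f := (bd \o proj F X)%VF)).
  - apply/subvP => y /memv_capP[/memv_capP[_ /memv_imgP[x0 x0X E0]]].
    move=> /memv_imgP[x1 x1Y E1].
    have -> : y = (bd \o proj F X)%VF (x0 + x1) + bd (proj F X x1).
      rewrite comp_lfunE !linearD /= -addrA (chain_addrr char2) addr0 E0.
      by rewrite proj_id //; apply: subvP x0X; apply: chainsS;
        apply/subsetP => s; rewrite inE => /andP[].
    apply: memv_add; last by apply/memv_img/pV.
    apply: memv_img; apply/cyclesP; split.
      apply: memvD; [apply: subvP x0X|apply: subvP x1Y]; apply/chainsS/facesS.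
        exact: subsetUl.
      exact: subsetUr.
    by rewrite linearD /= -E0 -E1 chain_addrr.
  - by apply: BZ => //; apply: simplicialU.
  apply/subvP => y /memv_imgP[u /memv_imgP[w wS ->] ->]; rewrite comp_lfunE.
  have Ew : w = proj F X w + (w + proj F X w).
    by rewrite addrC -addrA (chain_addrr char2) addr0.
  have w1Y : w + proj F X w \in chains (faces Y k.+2).
    apply/chainsP => s sY'; rewrite ffunE projE; case: ifP => sX'.
      exact: addrr_pchar2.
    rewrite addr0; move/chainsP: wS; apply.
    by move: sY'; rewrite !inE sX' /=.
  have w0X : proj F X w \in chains (faces X k.+2).
    by apply: (subvP (chainsS _ _)) (pV _ _ _ wS); apply/facesS/subsetIl.
  rewrite {}Ew; move: (proj F X w) w0X (w + _) w1Y => w0 w0X w1 w1Y.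
  have bdX (Z : {set {set T}}) z : simplicial Z ->
    z \in chains (faces Z k.+2) ->
      bd z \in chains (faces Z k.+1).
    move=> sZ zZ; have c := closed_faces (@simplicial_closed _ k.+1 Z sZ isT).
    exact: (subvP (bd_chains F c) _ (memv_img _ zZ)).
  rewrite 3!linearD /= proj_id ?bd_bd ?add0r //; first exact/memv_img/pV/bdX.
  apply: (subvP (chainsS _ _)) (bdX _ _ sX w0X).
  by apply/subsetP => s; rewrite inE => /andP[].
have := dimvS (BZ _ _ sX k0); have := dimvS (BZ _ _ sY k0).
have := dimvS (BZ _ k.+1 (simplicialU sX sY) isT).
rewrite /cbetti -/V -/S; lia.
Qed.

(** The boundary of a cone over a cycle is that cycle, and the image of a
    boundary is a cycle by induction. *)
Lemma carrier_chain_map (A B : finType) (apex : {set A} -> B) x :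
  let f := linext (carrier (delta set0) apex (fun=> 0)) in bd (f x) = f (bd x).
Proof.
move=> f; suff H s : (bd \o f)%VF (delta s) = (f \o bd)%VF (delta s).
  by have := hom_eq_delta H x; rewrite !comp_lfunE.
rewrite !comp_lfunE; have [m] := ubnP #|s|; elim: m s => // m IH s sm.
have [->|s0] := eqVneq s set0.
  by rewrite linext_delta carrier0 !bd_delta0 linear0.
rewrite {1}/f linext_delta carrierE // add0r -/f bd_cone //.
suff -> : bd (f (bd (delta s))) = 0 by rewrite linear0 addr0.
rewrite [in LHS]bd_delta_sum !linear_sum /=.
under eq_bigr => y ys.
  rewrite IH; last by move: sm; rewrite (cardsD1 y s) ys; lia.
  over.
by rewrite -!linear_sum /= -bd_delta_sum bd_bd // linear0.
Qed.

(** With [E = s + m s + h (bd s)], the induction hypothesis on the facets says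
    that [E] is a cycle, so the cone [h s] over it has boundary [E]. *)
Lemma carrier_homotopy (A : finType) (apex : {set A} -> A) (m : 'End(chain A))
  x :
  (forall y, bd (m y) = m (bd y)) -> m (delta set0) = delta set0 ->
  let h := linext (carrier 0 apex (fun s => delta s + m (delta s))) in
  bd (h x) + h (bd x) = x + m x.
Proof.
move=> mbd m0 h.
suff H s : ((bd \o h) + (h \o bd))%VF (delta s) = (\1 + m)%VF (delta s).
  by have := hom_eq_delta H x; rewrite !add_lfunE !comp_lfunE id_lfunE.
rewrite !add_lfunE !comp_lfunE id_lfunE.
have [n] := ubnP #|s|; elim: n s => // n IH s sn.
have [->|s0] := eqVneq s set0.
  by rewrite linext_delta carrier0 !bd_delta0 // !linear0 m0 addr0
    (chain_addrr char2).
rewrite {1}/h linext_delta carrierE // -/h bd_cone //.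
set E := delta s + m (delta s) + h (bd (delta s)).
suff -> : bd E = 0.
  by rewrite linear0 addr0 -addrA (chain_addrr char2) addr0.
rewrite /E 2!linearD /= mbd.
suff -> : bd (h (bd (delta s))) = bd (delta s) + m (bd (delta s)).
  by rewrite (chain_addrr char2).
have : bd (h (bd (delta s))) + h (bd (bd (delta s))) = bd (delta s) + m
  (bd (delta s)).
  rewrite bd_delta_sum !linear_sum /= -!big_split /=.
  apply: eq_bigr => y ys; apply: IH.
  by move: sn; rewrite (cardsD1 y s) ys; lia.
by rewrite bd_bd // linear0 addr0.
Qed.
End CharTwo.
End SubcomplexHomology.

(** * Flags and order complexes *)

Section Flags.
Variable T : finType.
Implicit Types (K P : {set {set T}}) (c : {set {set T}}) (U s t : {set T}).

Definition isflag c := [forall s in c, forall t in c, (s \subset t) ||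
  (t \subset s)].
(** Unlike the simplices of the order complex, flags may be empty: this matches
    the augmentation of chain complexes. *)
Definition flags P := [set c : {set {set T}} | (c \subset P) && isflag c].
Definition order_complex P := flags P :\ set0.
Definition meeting K U := [set s in K | s :&: U != set0].
Definition induced K U := [set s in K | s \subset U].
(** The union of a flag is its greatest element. *)
Definition top c : {set T} := \bigcup_(s in c) s.

Lemma flagP c : reflect (forall s t, s \in c -> t \in c ->
  (s \subset t) || (t \subset s)) (isflag c).
Proof.
apply: (iffP forall_inP) => [H s t sc tc|H s sc].
  exact: (forall_inP (H s sc)).
by apply/forall_inP => t tc; apply: H.
Qed.

Lemma flagsP P c : reflect ((forall s, s \in c -> s \in P) /\ isflag c)
  (c \in flags P).
Proof. by rewrite inE; apply: (iffP andP) => -[/subsetP]. Qed.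

Lemma isflagS c c' : c' \subset c -> isflag c -> isflag c'.
Proof. by move=> /subsetP sub /flagP H; apply/flagP => s t /sub sc /sub tc;
  apply: H. Qed.

Lemma flags_sub P c c' : c \in flags P -> c' \subset c -> c' \in flags P.
Proof.
rewrite !inE => /andP[cP fc] sub; rewrite (subset_trans sub cP).
exact: isflagS fc.
Qed.

Lemma flagsS P P' : P \subset P' -> flags P \subset flags P'.
Proof. by move=> PP; apply/subsetP => c;
  rewrite !inE => /andP[/subset_trans/(_ PP) -> ->]. Qed.

Lemma Sd_flags K : Sd K = order_complex K.
Proof. by apply/setP => c; rewrite !inE. Qed.

Lemma simplicial_order_complex P : simplicial (order_complex P).
Proof.
apply/andP; split; first by rewrite setD11.
apply/forall_inP => c; rewrite in_setD1 => /andP[_ cP]; apply/forallP => c'.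
by apply/implyP => /andP[c0 sub]; rewrite in_setD1 c0 (flags_sub cP).
Qed.

Lemma simplicial_induced K U : simplicial K -> simplicial (induced K U).
Proof.
move=> /andP[K0 /forall_inP cK]; apply/andP; split;
  first by rewrite inE (negPf K0).
apply/forall_inP => s; rewrite inE => /andP[sK sU]; apply/forallP => t.
apply/implyP => /andP[t0 ts]; rewrite inE (subset_trans ts sU) andbT.
by have /forallP/(_ t) := cK s sK; rewrite t0 ts.
Qed.

Lemma simplicialE K s t : simplicial K -> s \in K -> t != set0 ->
  t \subset s -> t \in K.
Proof.
move=> /andP[_ /forall_inP cK] sK t0 ts.
by have /forallP/(_ t) := cK s sK; rewrite t0 ts.
Qed.

Lemma sub_top c s : s \in c -> s \subset top c.
Proof. by move=> sc; apply: bigcup_sup. Qed.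

Lemma topS c c' : c' \subset c -> top c' \subset top c.
Proof. by move=> /subsetP sub; apply/bigcupsP => s /sub /sub_top. Qed.

Lemma top_mem c : isflag c -> c != set0 -> top c \in c.
Proof.
move=> /flagP fc /set0Pn[s0 s0c].
case: (arg_maxnP (fun s : {set T} => #|s|) s0c) => m mc max.
suff -> : top c = m by [].
apply/eqP; rewrite eqEsubset sub_top // andbT; apply/bigcupsP => s sc.
have /orP[//|ms] := fc s m sc mc.
by have /eqP <- : m == s by rewrite eqEcard ms; apply: max.
Qed.

Lemma isflagU1 c s : isflag c -> (forall t, t \in c -> t \subset s) ->
  isflag (s |: c).
Proof.
move=> /flagP fc H; apply/flagP => a b; rewrite !in_setU1.
move=> /orP[/eqP->|ac] /orP[/eqP->|bc]; rewrite ?subxx ?(H a) ?(H b) ?orbT //.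
exact: fc.
Qed.
End Flags.

(** Flags of simplices meeting [U] retract onto the subcomplex induced on [U].
    The map [collapse] sends a flag to the simplex spanned by chosen vertices in
    [U] of its elements, or to 0 if two of these coincide, and [subdivide] is
    barycentric subdivision.  Both a flag [c] and its image under
    [subdivide \o collapse] lie in the complex of flags below [top c], which is
    a cone with apex [top c]; so [prism_] is a homotopy from the identity to
    this composite, and [collapse] is injective in homology. *)
Section Retract.
Variable (F : fieldType).
Hypothesis char2 : 2%N \in [pchar F].
Variables (T : finType) (K : {set {set T}}) (U : {set T}) (x0 : T).
Hypothesis sK : simplicial K.
Local Notation chain T := {ffun {set T} -> F^o}.
Local Notation delta := (@delta F _).
Local Notation bd := (bd F _).
Local Notation chains := (@chains F _).
Local Notation linext := (@linext F _ _).
Local Notation cone := (@cone F _).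

Let P := meeting K U.

Let vtop (c : {set {set T}}) : T := odflt x0 [pick x in top c :&: U].
Let collapse_ c := carrier (delta set0) vtop (fun=> 0) c.
Let collapse : 'Hom(chain {set T}, chain T) := linext collapse_.
Let subdivide_ s := carrier (delta set0) (fun s : {set T} => s) (fun=> 0) s.
Let subdivide : 'Hom(chain T, chain {set T}) := linext subdivide_.
Let prism_base c : chain {set T} := delta c + (subdivide \o collapse)%VF
  (delta c).
Let prism_ c := carrier 0 (@top T) prism_base c.

Let below c := [set t : {set T} | t \subset top c :&: U].

Lemma top_meeting c : c \in flags P -> c != set0 -> top c \in P.
Proof. by move=> /flagsP[cP fc] c0; apply/cP/top_mem. Qed.

Lemma collapse_supp c : c \in flags P -> collapse_ c \in chains (below c).
Proof.
apply: carrier_supp => //.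
- by move=> s x sF _; apply: flags_sub sF _; apply: subsetDl.
- move=> s x _ _; apply/subsetP => t; rewrite !inE => /subset_trans; apply.
  by apply: setSI; apply: topS; apply: subsetDl.
- by rewrite delta_chains inE sub0set.
- by move=> *; apply: mem0v.
move=> s t sF s0; rewrite !inE => ts; rewrite subUset ts andbT sub1set.
rewrite /vtop; case: pickP => [x|] //= H.
by have := top_meeting sF s0; rewrite inE => /andP[_ /set0Pn[y]]; rewrite H.
Qed.

Lemma collapse_size c : collapse_ c \in chains [set t : {set T} | #|t| == #|c|].
Proof.
have := @carrier_size F _ _ (delta set0) vtop (fun=> 0) 0; rewrite /collapse_.
move=> H; have := H _ _ c; rewrite addn0; apply.
  by rewrite delta_chains inE cards0.
by move=> s; apply: mem0v.
Qed.

Lemma subdivide_supp s : subdivide_ s \in chains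
  (flags [set t | (t != set0) && (t \subset s)]).
Proof.
apply: (carrier_supp (X := setT)
  (Q := fun s => flags [set t | (t != set0) && (t \subset s)])) => //.
- by move=> *; rewrite inE.
- move=> u x _ _ /=; apply: flagsS; apply/subsetP => t;
  rewrite !inE => /andP[-> /subset_trans]; apply.
  exact: subsetDl.
- rewrite delta_chains; apply/flagsP; split => [t|]; first by rewrite inE.
  by apply/flagP => a b; rewrite inE.
- by move=> *; apply: mem0v.
move=> u c _ u0 /flagsP[cu fc]; apply/flagsP; split.
  by move=> t; rewrite in_setU1 => /orP[/eqP->|/cu //]; rewrite inE u0 subxx.
by apply: isflagU1 => // t /cu; rewrite inE => /andP[].
Qed.

Lemma subdivide_size c : subdivide_ c \in chains
  [set t : {set {set T}} | #|t| == #|c|].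
Proof.
have := @carrier_size F _ _ (delta set0) (fun s : {set T} => s) (fun=> 0) 0;
  rewrite /subdivide_.
move=> H; have := H _ _ c; rewrite addn0; apply.
  by rewrite delta_chains inE cards0.
by move=> s; apply: mem0v.
Qed.

Lemma subdivide_collapse_supp c : c \in flags P ->
  subdivide (collapse (delta c)) \in
    chains (flags [set t in P | t \subset top c] :&:
            [set t : {set {set T}} | #|t| == #|c|]).
Proof.
move=> cF; rewrite /collapse linext_delta.
have : collapse_ c \in chains (below c :&: [set t : {set T} | #|t| == #|c|]).
  by rewrite -chainsI memv_cap collapse_supp ?collapse_size.
move=> H; apply: (linext_chains H) => s; rewrite !inE => /andP[ss /eqP sc].
rewrite -chainsI memv_cap -sc subdivide_size andbT.
apply: (subvP (chainsS _ _)) (subdivide_supp s); apply: flagsS;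
  apply/subsetP => t.
rewrite !inE => /andP[t0 ts].
have [c0|c0] := eqVneq c set0.
  move: ss ts; rewrite /top c0 big_set0 set0I subset0 => /eqP ->.
  by rewrite subset0 (negPf t0).
have /subsetIP[tc tU] := subset_trans ts ss.
rewrite tc andbT; have := top_meeting cF c0; rewrite inE => /andP[topK _].
by rewrite (simplicialE sK topK) // (setIidPl tU).
Qed.

Lemma prism_supp c : c \in flags P ->
  prism_ c \in chains (flags [set t in P | t \subset top c]).
Proof.
apply: (carrier_supp (Q := fun c => flags [set t in P | t \subset top c])).
- by move=> s x sF _; apply: flags_sub sF _; apply: subsetDl.
- move=> s x _ _; apply: flagsS; apply/subsetP => t;
  rewrite !inE => /andP[-> /subset_trans]; apply.
  by apply: topS; apply: subsetDl.
- exact: mem0v.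
- move=> s sF s0; rewrite /prism_base comp_lfunE; apply: memvD.
    rewrite delta_chains; case/flagsP: (sF) => sP fs; apply/flagsP;
      split => // t ts.
    by rewrite inE sP // sub_top.
  by apply: (subvP (chainsS _ (subsetIl _ _))) (subdivide_collapse_supp sF).
move=> s t sF s0 /flagsP[tP ft]; apply/flagsP; split.
  move=> u; rewrite in_setU1 => /orP[/eqP->|/tP //]; rewrite inE subxx andbT.
  exact: top_meeting.
by apply: isflagU1 => // u /tP; rewrite inE => /andP[].
Qed.

Lemma subdivide_collapse_size c : subdivide (collapse (delta c)) \in chains
  [set t : {set {set T}} | #|t| == #|c|].
Proof.
rewrite /collapse linext_delta; apply: (linext_chains (collapse_size c)) => s;
  rewrite inE => /eqP <-.
exact: subdivide_size.
Qed.

Lemma prism_size c : prism_ c \in chains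
  [set t : {set {set T}} | #|t| == #|c|.+1].
Proof.
rewrite -addn1; apply: (@carrier_size F _ _ 0 (@top T) prism_base);
  first exact: mem0v.
move=> s; under eq_finset => t do rewrite addn1 eqSS.
by rewrite /prism_base comp_lfunE memvD ?subdivide_collapse_size
  // delta_chains inE.
Qed.

Lemma faces_order_complex Q k : (0 < k)%N ->
  faces (order_complex Q) k = flags Q :&: [set t : {set {set T}} | #|t| == k].
Proof.
move=> k0; apply/setP => c; rewrite !inE -card_gt0.
by case: eqP => [->|]; rewrite ?k0 ?andbT ?andbF.
Qed.

Lemma cbetti_order_meeting k : (0 < k)%N ->
  (cbetti F k (order_complex P) <= cbetti F k (induced K U))%N.
Proof.
move=> k0.
have kerN j x : (0 < j)%N -> x \in chains (faces (order_complex P) j) ->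
    collapse x \in chains (faces (induced K U) j).
  move=> j0 xX; apply: (linext_chains xX) => c.
  rewrite faces_order_complex // => /setIP[cF]; rewrite inE => /eqP cj.
  have : collapse_ c \in chains (below c :&: [set t : {set T} | #|t| == #|c|]).
    by rewrite -chainsI memv_cap collapse_supp ?collapse_size.
  apply: subvP; apply: chainsS; apply/subsetP => t;
    rewrite cj !inE => /andP[/subsetIP[tt tU] tj].
  have c0 : c != set0 by rewrite -card_gt0 cj.
  rewrite tU tj !andbT; have := top_meeting cF c0; rewrite inE => /andP[topK _].
  by apply: (simplicialE sK topK) => //; rewrite -card_gt0 (eqP tj).
have phiN j x : (0 < j)%N -> x \in chains (faces (induced K U) j) ->
    subdivide x \in chains (faces (order_complex P) j).
  move=> j0 xX; apply: (linext_chains xX) => s;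
    rewrite !inE => /andP[/andP[sX sU] /eqP sj].
  have : subdivide_ s \in chains
    (flags [set t | (t != set0) && (t \subset s)] :&:
    [set t : {set {set T}} | #|t| == #|s|]).
    by rewrite -chainsI memv_cap subdivide_supp ?subdivide_size.
  apply: subvP; apply: chainsS; rewrite faces_order_complex // sj; apply: setSI.
  apply: flagsS; apply/subsetP => t; rewrite !inE => /andP[t0 ts].
  by rewrite (simplicialE sK sX) // (setIidPl (subset_trans ts sU)).
have hN j x : (0 < j)%N -> x \in chains (faces (order_complex P) j) ->
    linext prism_ x \in chains (faces (order_complex P) j.+1).
  move=> j0 xX; apply: (linext_chains xX) => c.
  rewrite !faces_order_complex // => /setIP[cF]; rewrite inE => /eqP cj.
  have : prism_ c \in chains (flags [set t in P | t \subset top c] :&: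
    [set t : {set {set T}} | #|t| == #|c|.+1]).
    by rewrite -chainsI memv_cap prism_supp ?prism_size.
  apply: subvP; apply: chainsS; rewrite cj; apply: setSI; apply: flagsS.
  by apply/subsetP => t; rewrite inE => /andP[].
have sI := simplicial_induced U sK.
have sP := simplicial_order_complex P.
have BZ := dimvS (boundaries_sub char2 (simplicial_closed sI k0)).
have BZ' := dimvS (boundaries_sub char2 (simplicial_closed sP k0)).
suff : (\dim (cycles F k (order_complex P)) + \dim
  (boundaries F k (induced K U)) <=
  \dim (cycles F k (induced K U)) + \dim (boundaries F k (order_complex P)))%N.
  by rewrite /cbetti; lia.
apply: (dim_quotient_inj (f := collapse)).
- apply/subvP => y /memv_imgP[z /cyclesP[zX bz] ->]; apply/cyclesP; split;
  first exact: kerN.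
  by rewrite carrier_chain_map // bz linear0.
- exact: boundaries_sub (simplicial_closed sI k0).
move=> z /cyclesP[zX bz] /memv_imgP[y yX Ey].
have mbd u : bd ((subdivide \o collapse)%VF u) = (subdivide \o collapse)%VF
  (bd u).
  by rewrite !comp_lfunE !carrier_chain_map.
have m0 : (subdivide \o collapse)%VF (delta set0) = delta set0.
  by rewrite comp_lfunE /collapse linext_delta /collapse_ carrier0 /subdivide
    linext_delta /subdivide_ carrier0.
have := carrier_homotopy char2 (@top T) z mbd m0.
rewrite /= bz linear0 addr0 comp_lfunE Ey => E.
have Ez : z = bd (linext prism_ z + subdivide y).
  rewrite linearD /= E carrier_chain_map // -/subdivide -addrA
    (chain_addrr char2).
  by rewrite addr0.
rewrite Ez; apply: memv_img; apply: memvD; [exact: hN|exact: phiN].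
Qed.
End Retract.

(** * The hypersurface between the two colors *)

Section Subdivision.
Variable (F : fieldType).
Hypothesis char2 : 2%N \in [pchar F].

Lemma cbetti_set0 (T : finType) k : cbetti F k (set0 : {set {set T}}) = 0%N.
Proof.
apply/eqP; rewrite /cbetti subn_eq0 (@leq_trans 0) //.
rewrite -(cards0 {set T}) -(dim_chains F) dimvS //.
apply: subv_trans (capvSl _ _) _; apply: chainsS.
by apply/subsetP => s; rewrite !inE.
Qed.

Lemma cbetti_meeting_le (T : finType) (K : {set {set T}}) U k : simplicial K ->
  (0 < k)%N ->
  (cbetti F k (order_complex (meeting K U)) <= cbetti F k (induced K U))%N.
Proof.
move=> sK k0; case: (set_0Vmem [set: T]) => [T0|[x _]];
  last exact: cbetti_order_meeting.
suff -> : order_complex (meeting K U) = set0 by rewrite cbetti_set0.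
apply/setP => c; rewrite !inE; apply/negP => /andP[c0 /andP[/subsetP cK _]].
have /set0Pn[s /cK] := c0; rewrite inE => /andP[_ /set0Pn[x _]].
by have := in_set0 x; rewrite -T0 inE.
Qed.

(** This is the retraction for the set [U] of all vertices. *)
Lemma cbetti_Sd_le (T : finType) (K : {set {set T}}) k : simplicial K ->
  (0 < k)%N ->
  (cbetti F k (Sd K) <= cbetti F k K)%N.
Proof.
move=> sK k0.
have := @cbetti_meeting_le T K setT k sK k0.
suff [-> ->] : meeting K setT = K /\ induced K setT = K by rewrite Sd_flags.
split; apply/setP => s; rewrite inE ?subsetT ?andbT // setIT.
apply: andb_idr => sK'; apply/eqP => s0; case/andP: sK => /negP[].
by rewrite -s0.
Qed.
End Subdivision.

Lemma F2_cases (x : 'F_2) : (x == 0) || (x == 1).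
Proof. by case: x => [[|[|]]]. Qed.

Section Hypersurface.
Variables (T : finType) (K : {set {set T}}) (eps : cochain0 K).
Hypothesis sK : simplicial K.

Definition colored (a : 'F_2) : {set T} :=
  [set val v | v : vertex K & eps v == a].

Lemma coloredP (a : 'F_2) x :
  reflect (exists2 v : vertex K, val v = x & eps v = a) (x \in colored a).
Proof.
apply: (iffP imsetP) => [[v]|[v <- va]]; last by exists v; rewrite // inE va.
by rewrite inE => /eqP va ->; exists v.
Qed.

Lemma simplex_neq0 s : s \in K -> s != set0.
Proof. by case/andP: sK => /negP K0 _ sK'; apply/eqP => s0; case: K0;
  rewrite -s0. Qed.

Lemma simplex_vertex s x : s \in K -> x \in s -> exists v : vertex K, val v = x.
Proof.
move=> sK' xs; have xK : [set x] \in K.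
  by apply: (simplicialE sK sK'); rewrite ?sub1set // -card_gt0 cards1.
by exists (Sub x xK).
Qed.

Lemma nonconstP s : s \in K ->
  nonconst eps s = (s :&: colored 0 != set0) && (s :&: colored 1 != set0).
Proof.
move=> sK'; apply/existsP/andP.
  move=> [u /existsP[v /and3P[us vs uv]]].
  have cu : val u \in colored (eps u) by apply/coloredP; exists u.
  have cv : val v \in colored (eps v) by apply/coloredP; exists v.
  have Hu : s :&: colored (eps u) != set0 by apply/set0Pn; exists (val u);
    apply/setIP.
  have Hv : s :&: colored (eps v) != set0 by apply/set0Pn; exists (val v);
    apply/setIP.
  move: uv Hu Hv; have /orP[/eqP->|/eqP->] := F2_cases (eps u);
    by have /orP[/eqP->|/eqP->] := F2_cases (eps v); rewrite ?eqxx.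
move=> [/set0Pn[x /setIP[xs /coloredP[u ux u0]]]
  /set0Pn[y /setIP[ys /coloredP[v vy v1]]]].
by exists u; apply/existsP; exists v; rewrite ux vy xs ys u0 v1.
Qed.

Lemma bottom_mem (c : {set {set T}}) : isflag c -> c != set0 ->
  exists2 s, s \in c & forall t, t \in c -> s \subset t.
Proof.
move=> /flagP fc /set0Pn[s0 s0c].
case: (arg_minnP (fun s : {set T} => #|s|) s0c) => m mc min.
exists m => // s sc; have /orP[//|sm] := fc m s mc sc.
by have /eqP -> : s == m by rewrite eqEcard sm; apply: min.
Qed.

Lemma meeting_up U s t : s \in meeting K U -> t \in K -> s \subset t ->
  t \in meeting K U.
Proof.
rewrite !inE => /andP[_ /set0Pn[x /setIP[xs xU]]] -> /subsetP st.
by apply/set0Pn; exists x; rewrite inE st.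
Qed.

Lemma order_complexP (P : {set {set T}}) c :
  reflect [/\ c != set0, (forall s, s \in c -> s \in P) & isflag c]
    (c \in order_complex P).
Proof.
rewrite in_setD1; apply: (iffP andP) => [[c0 /flagsP[]]|[c0 cP fc]] //.
by split => //; apply/flagsP.
Qed.

(** A flag lies in the hypersurface exactly when all its elements are
    nonconstant: below the least of them there is then an edge joining two
    vertices of different colors, by which the flag can be extended. *)
Lemma Veps_inter :
  Veps eps = order_complex (meeting K (colored 0)) :&:
             order_complex (meeting K (colored 1)).
Proof.
apply/setP => c; rewrite inE [RHS]inE; apply/andP/andP.
  move=> [c0 /existsP[c' /and3P[c'K cc'
    /existsP[e /and4P[ec' /forall_inP emin ecard]]]]].
  have : c' \in Sd K by [].
  rewrite Sd_flags => /order_complexP[_ c'K' fc'] nce.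
  move: (nce); rewrite nonconstP ?c'K' // => /andP[e0 e1].
  have fc := isflagS cc' fc'; move/subsetP: cc' => cc'.
  have sub U : e :&: U != set0 -> c \in order_complex (meeting K U).
    move=> eU; apply/order_complexP; split => // s /cc' sc.
    by apply: (@meeting_up _ e); rewrite ?c'K' ?emin // inE eU c'K'.
  by rewrite !sub.
move=> [/order_complexP[c0 cP fc] /order_complexP[_ cP' _]]; split=> //.
have [s sc smin] := bottom_mem fc c0.
have := cP s sc; rewrite inE => /andP[sK' /set0Pn[x /setIP[xs xc]]].
have := cP' s sc; rewrite inE => /andP[_ /set0Pn[y /setIP[ys yc]]].
have es : [set x; y] \subset s by rewrite subUset !sub1set xs ys.
have e0 : [set x; y] != set0 by apply/set0Pn; exists x; rewrite !inE eqxx.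
have eK := simplicialE sK sK' e0 es.
have emin t : t \in c -> [set x; y] \subset t.
  by move=> tc; apply: subset_trans es _; apply: smin.
have xy : x != y.
  apply/eqP => xy; case/coloredP: xc => u ux u0; case/coloredP: yc => v vy v1.
  have uv : u = v by apply: val_inj; rewrite ux vy.
  by move: v1; rewrite -uv u0.
apply/existsP; exists ([set x; y] |: c); rewrite subsetUr; apply/and3P;
  split => //.
  rewrite Sd_flags; apply/order_complexP; split.
  - by apply/set0Pn; exists [set x; y]; rewrite setU11.
  - move=> t; rewrite in_setU1 => /orP[/eqP -> //|/cP].
    by rewrite inE => /andP[].
  apply/flagP => a b; rewrite !in_setU1 => /orP[/eqP->|ac] /orP[/eqP->|bc].
  - by rewrite subxx.
  - by rewrite emin.
  - by rewrite emin ?orbT.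
  exact: (flagP _ fc).
apply/existsP; exists [set x; y]; rewrite setU11 cards2 xy /=; apply/andP;
  split.
  by apply/forall_inP => t; rewrite in_setU1 => /orP[/eqP->|/emin].
rewrite nonconstP //; apply/andP; split; apply/set0Pn.
  by exists x; rewrite !inE eqxx.
by exists y; rewrite !inE eqxx orbT.
Qed.

(** The least element of a flag has a vertex of some color, which all the other
    elements share. *)
Lemma Sd_union :
  Sd K = order_complex (meeting K (colored 0)) :|:
         order_complex (meeting K (colored 1)).
Proof.
apply/setP => c; rewrite Sd_flags [RHS]inE; apply/order_complexP/orP;
  last first.
  by case=> /order_complexP[c0 cP fc]; split => // s /cP;
    rewrite inE => /andP[].
move=> [c0 cK fc]; have [s sc smin] := bottom_mem fc c0.
have /set0Pn[x xs] := simplex_neq0 (cK s sc).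
have [v vx] := simplex_vertex (cK s sc) xs.
have sub : c \in order_complex (meeting K (colored (eps v))).
  apply/order_complexP; split => // t tc; apply: (@meeting_up _ s);
    rewrite ?cK ?smin //.
  rewrite inE cK //=; apply/set0Pn; exists x; rewrite inE xs; apply/coloredP.
  by exists v.
have /orP[/eqP E|/eqP E] := F2_cases (eps v); rewrite E in sub;
  [by left|by right].
Qed.

Lemma betti_Veps_le p : (0 < p)%N ->
  (betti (Veps eps) p <= cbetti 'F_2 p.+2 (Sd K)
    + cbetti 'F_2 p.+1 (induced K (colored 0%R))
    + cbetti 'F_2 p.+1 (induced K (colored 1%R)))%N.
Proof.
move=> p0; have sO := simplicial_order_complex.
rewrite betti_cbetti //; last by rewrite Veps_inter; apply: simplicialI.
rewrite Veps_inter Sd_union.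
apply: leq_trans (mayer_vietoris_cbetti char2_F2 _ _ _) _ => //.
by rewrite !leq_add // cbetti_meeting_le // char2_F2.
Qed.
End Hypersurface.

(** * Random induced subcomplexes *)

Section Bases.
Variable (F : fieldType) (T : finType).
Local Notation chain T := {ffun {set T} -> F^o}.
Local Notation delta := (@delta F _).
Local Notation bd := (bd F _).
Local Notation chains := (@chains F _).
Local Notation proj := (@proj F T).
Implicit Types (E J X : {set {set T}}) (Z B : {vspace chain T}).

(** The set [J] is an information set of the linear code [Z].  Split off a
    coordinate that does not vanish on all of [Z] and continue with the
    hyperplane where it does. *)
Lemma information_set Z E : (Z <= chains E)%VS ->
  exists J, [/\ J \subset E, #|J| = \dim Z &
    forall z, z \in Z -> (forall s, s \in J -> z s = 0) -> z = 0].
Proof.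
have [m] := ubnP (\dim Z); elim: m Z E => // m IH Z E; rewrite ltnS => Zm ZE.
have [Z0|Z0] := eqVneq Z 0%VS.
  exists set0; rewrite Z0 sub0set cards0 dimv0; split => // z.
  by rewrite memv0 => /eqP.
have zZ := memv_pick Z; set z := vpick Z in zZ.
have [s zs] : exists s, z s != 0.
  apply/existsP; apply: contraNT Z0 => /existsPn z0; rewrite -vpick0.
  by apply/eqP/ffunP => s; rewrite ffunE; have /negbNE/eqP := z0 s.
pose Z' := (Z :&: chains (E :\ s))%VS.
have sE : s \in E.
  by apply/negPn/negP => sE; case/negP: zs;
    have /chainsP/(_ s sE) -> := subvP ZE _ zZ.
have kerE : (Z :&: lker (proj [set s]))%VS = Z'.
  apply/vspaceP => x; rewrite !memv_cap memv_ker; case xZ: (x \in Z) => //=.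
  have xE := subvP ZE _ xZ.
  apply/eqP/chainsP => [/ffunP x0 t|H].
    rewrite !inE negb_and negbK => /orP[/eqP->|]; last by move/chainsP: xE;
      apply.
    by have := x0 s; rewrite projE inE eqxx ffunE.
  apply/ffunP => t; rewrite projE inE ffunE; case: eqP => // ->.
  by apply: H; rewrite setD11.
have dimI : \dim (proj [set s] @: Z) = 1%N.
  apply/eqP; rewrite eqn_leq; apply/andP; split.
    rewrite -(cards1 s) -(dim_chains F) dimvS //;
      apply/subvP => y /memv_imgP[x _ ->].
    exact: proj_chains.
  rewrite lt0n dimv_eq0; apply/eqP => I0; case/negP: zs.
  have : proj [set s] z \in (proj [set s] @: Z)%VS by apply: memv_img.
  by rewrite I0 memv0 => /eqP/ffunP/(_ s); rewrite projE inE eqxx ffunE => ->.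
have := limg_ker_dim (proj [set s]) Z; rewrite kerE dimI => dimZ.
have [|J [JE Jc HJ]] := IH Z' (E :\ s) _ (capvSr _ _);
  first by apply: leq_trans Zm; rewrite -dimZ addn1.
have sJ : s \notin J by apply/negP => /(subsetP JE); rewrite setD11.
exists (s |: J); split.
- by rewrite subUset sub1set sE (subset_trans JE) // subsetDl.
- by rewrite cardsU1 sJ Jc -dimZ addnC.
move=> x xZ H; apply: HJ => [|t tJ]; last by apply: H; rewrite inE tJ orbT.
rewrite memv_cap xZ; apply/chainsP => t; rewrite !inE negb_and negbK.
move=> /orP[/eqP->|tE]; first by apply: H; rewrite setU11.
by have /chainsP/(_ t tE) := subvP ZE _ xZ.
Qed.

(** The same modulo the chains supported in [E']: forget the coordinates in
    [E'], that is, restrict to the complement. *)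
Lemma relative_information_set Z E E' : (Z <= chains E)%VS ->
  exists J, [/\ J \subset E, (#|J| + \dim (Z :&: chains E'))%N = \dim Z &
    forall z, z \in Z -> (forall s, s \in J -> z s = 0) -> z \in chains E'].
Proof.
move=> ZE; have kerE : (Z :&: lker (proj (E :\: E')))%VS = (Z :&: chains E')%VS.
  apply/vspaceP => x; rewrite !memv_cap memv_ker; case xZ: (x \in Z) => //=.
  have xE := subvP ZE _ xZ.
  apply/eqP/chainsP => [/ffunP x0 t tE'|H].
    have := x0 t; rewrite projE inE tE' ffunE /=; case: ifP => // tE _.
    by move/chainsP: xE; apply; rewrite tE.
  by apply/ffunP => t; rewrite projE inE ffunE; case: ifP => // /andP[/H].
have sub : (proj (E :\: E') @: Z <= chains (E :\: E'))%VS.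
  by apply/subvP => y /memv_imgP[x _ ->]; apply: proj_chains.
have [J [JE Jc HJ]] := information_set sub.
exists J; split; first exact: subset_trans JE (subsetDl _ _).
  by rewrite -kerE Jc addnC limg_ker_dim.
move=> z zZ H; suff : z \in (Z :&: chains E')%VS by rewrite memv_cap => /andP[].
rewrite -kerE memv_cap zZ memv_ker; apply/eqP; apply: HJ; first exact: memv_img.
by move=> s sJ; rewrite projE (subsetP JE) // H.
Qed.

Section Independent.
Variables (vT : vectType F) (f : 'Hom(chain T, vT)) (B0 : {vspace vT}).
Definition independent_mod X := forall x, x \in chains X -> f x \in B0 -> x = 0.

Lemma independent_modS X X' : X \subset X' -> independent_mod X' ->
  independent_mod X.
Proof. by move=> XX H x /(subvP (chainsS _ XX)); apply: H. Qed.

Lemma dim_independent_mod X (B1 : {vspace vT}) : independent_mod X ->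
  (B1 <= B0)%VS ->
  \dim (f @: chains X + B1) = (#|X| + \dim B1)%N.
Proof.
move=> H BB; have := dimv_sum_cap (f @: chains X)%VS B1.
have -> : (f @: chains X :&: B1)%VS = 0%VS.
  apply/eqP; rewrite -subv0; apply/subvP => y
    /memv_capP[/memv_imgP[x xX ->] /(subvP BB)].
  by move/(H _ xX) ->; rewrite linear0 mem0v.
rewrite dimv0 addn0 => ->; congr (_ + _)%N.
rewrite limg_dim_eq ?dim_chains //; apply/eqP; rewrite -subv0; apply/subvP => x.
by move=> /memv_capP[xX]; rewrite memv_ker => /eqP fx;
  rewrite (H x) ?mem0v ?fx ?mem0v.
Qed.

(** A basis of [B0] is completed greedily among the images of single
    simplices. *)
Lemma relative_basis Y : (B0 <= f @: chains Y)%VS ->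
  exists X, [/\ X \subset Y, (#|X| + \dim B0)%N = \dim (f @: chains Y) &
    independent_mod X].
Proof.
move=> BY; suff H m : (m + \dim B0 <= \dim (f @: chains Y))%N ->
    exists X, [/\ X \subset Y, #|X| = m & independent_mod X].
  have /H[X [XY Xc HX]] : (\dim (f @: chains Y) - \dim B0 + \dim B0 <=
    \dim (f @: chains Y))%N.
    by rewrite subnK // dimvS.
  by exists X; rewrite Xc subnK ?dimvS.
elim: m => [_|m IH Hm].
  exists set0; rewrite sub0set cards0; split => // x /chainsP H _.
  by apply/ffunP => s; rewrite ffunE H // inE.
have [|X [XY Xc HX]] := IH; first by lia.
have [sub|] := boolP [forall s in Y, f (delta s) \in f @: chains X + B0]%VS.
  suff /dimvS : (f @: chains Y <= f @: chains X + B0)%VS.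
    by rewrite (dim_independent_mod HX (subvv _)) Xc; lia.
  rewrite limg_chains; apply/span_subvP => y /mapP[s].
  by rewrite mem_enum => sY ->; exact: (forall_inP sub).
rewrite negb_forall_in => /exists_inP[s sY sn].
have sX : s \notin X.
  apply: contra sn => sX; apply: (subvP (addvSl _ _)); apply: memv_img.
  by rewrite delta_chains.
exists (s |: X); split; [by rewrite subUset sub1set sY|by rewrite cardsU1 sX
  Xc|].
move=> x xX fx; apply: HX => //; apply/chainsP => t tX.
have [->|ts] := eqVneq t s; last first.
  by move/chainsP: xX; apply; rewrite !inE negb_or ts.
apply/eqP; apply: contraNT sn => xs.
have E : x = x s *: delta s + proj X x.
  apply/ffunP => u; rewrite !ffunE projE; case: eqP => [->|us].
    by rewrite (negPf sX) addr0 [RHS]mulr1.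
  rewrite scaler0 add0r; case: ifP => // uX; move/chainsP: xX; apply.
  by rewrite !inE uX orbF; apply/eqP.
have -> : delta s = (x s)^-1 *: (x - proj X x).
  have -> : x - proj X x = x s *: delta s by apply/eqP; rewrite subr_eq -E.
  by rewrite scalerA mulVf // scale1r.
rewrite linearZ memvZ // linearB /= -[_ - _]addrC memv_add // memvN.
by apply: memv_img; apply: proj_chains.
Qed.
End Independent.
End Bases.

Section RelativeBound.
Variable (F : fieldType).
Hypothesis char2 : 2%N \in [pchar F].
Variables (T : finType) (K W : {set {set T}}) (k : nat).
Hypotheses (sK : simplicial K) (WK : W \subset K) (k0 : (0 < k)%N).
Local Notation chain T := {ffun {set T} -> F^o}.
Local Notation bd := (bd F _).
Local Notation chains := (@chains F _).

Lemma faces_induced (X : {set {set T}}) U j :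
  faces (induced X U) j = faces X j :&: [set s : {set T} | s \subset U].
Proof. by apply/setP => s; rewrite !inE andbAC. Qed.

(** The heart of the bound: one pair of sets serves all the vertex sets [U] at
    once.  Take for [J] coordinates that determine the cycles of [K] modulo
    those of [W], and for [X] simplices whose boundaries complete a basis of
    the boundaries of [W].  A cycle of the subcomplex induced on [U] is
    determined, modulo the cycles of [W] in [U], by its coordinates in [J]
    lying in [U]; and the simplices of [X] in [U] give boundaries independent
    of those of [W] in [U].  The contribution of [W] in [U] cancels, as its
    cycles are boundaries. *)
Lemma induced_betti_bound : exists J X : {set {set T}},
  [/\ J \subset faces K k, X \subset faces K k.+1,
      (#|J| + \dim (cycles F k W))%N = \dim (cycles F k K),
      (#|X| + \dim (boundaries F k W))%N = \dim (boundaries F k K) &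
      forall U : {set T}, cbetti F k (induced W U) = 0%N ->
        (cbetti F k (induced K U) + #|X :&: [set s : {set T} | s \subset U]| <=
         #|J :&: [set s : {set T} | s \subset U]|)%N].
Proof.
have [J [JK Jc HJ]] := @relative_information_set F T _ _ (faces W k)
  (capvSl _ _ : (cycles F k K <= chains (faces K k))%VS).
have [X [XK Xc HX]] := relative_basis (boundariesS F k WK).
exists J, X; split => //.
  rewrite -Jc; congr (_ + \dim _)%N; apply/vspaceP => z;
    apply/cyclesP/memv_capP.
    move=> [zW bz]; split => //; apply/cyclesP; split => //.
    by apply: (subvP (chainsS _ _)) zW; apply: facesS.
  by move=> [/cyclesP[_ bz] zW].
move=> U; set inU := [set s : {set T} | s \subset U].
rewrite /cbetti => /eqP; rewrite subn_eq0 => hW.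
have sub : (bd @: chains (X :&: inU) + boundaries F k (induced W U) <=
  boundaries F k (induced K U))%VS.
  rewrite subv_add; apply/andP; split.
    by apply: limgS; apply: chainsS; rewrite faces_induced; apply: setSI.
  apply: boundariesS; apply/subsetP => s;
    rewrite !inE => /andP[/(subsetP WK) -> ->] //.
have := dimvS sub; rewrite (dim_independent_mod (B0 := boundaries F k W));
  last 2 first.
- exact: independent_modS (subsetIl _ _) HX.
- by apply: boundariesS; apply/subsetP => s; rewrite !inE => /andP[].
have := limg_ker_dim (proj F J) (cycles F k (induced K U)).
have : (proj F J @: cycles F k (induced K U) <= chains (J :&: inU))%VS.
  apply/subvP => y /memv_imgP[z /cyclesP[/chainsP zK _] ->]; apply/chainsP => s.
  rewrite inE projE; case: ifP => //= sJ; rewrite inE => sU; apply: zK.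
  by rewrite faces_induced !inE (negPf sU) andbF.
move/dimvS; rewrite dim_chains.
have : (cycles F k (induced K U) :&: lker (proj F J) <=
  cycles F k (induced W U))%VS.
  apply/subvP => z /memv_capP[/cyclesP[zK bz]];
    rewrite memv_ker => /eqP /ffunP z0.
  apply/cyclesP; split => //; rewrite faces_induced -chainsI memv_cap;
    apply/andP; split; last first.
    by apply: (subvP (chainsS _ _)) zK; rewrite faces_induced subsetIr.
  apply: HJ => [|s sJ]; last by have := z0 s; rewrite projE sJ ffunE.
  apply/cyclesP; split => //.
  by apply: (subvP (chainsS _ _)) zK; rewrite faces_induced subsetIl.
move/dimvS.
have := dimvS (boundaries_sub char2
  (simplicial_closed (simplicial_induced U sK) k0)).
have arith (z b zw bw kr im j x : nat) : (b <= z -> kr <= zw -> im <= j ->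
  kr + im = z -> x + bw <= b -> zw <= bw -> z - b + x <= j)%N by lia.
move=> h1 h2 h3 h4 h5; exact: arith h1 h2 h3 h4 h5 hW.
Qed.
End RelativeBound.

Section Expectation.
Variables (R : realType) (nu : R) (T : finType) (K : {set {set T}}).
Hypothesis sK : simplicial K.

Definition weight (a : 'F_2) : R := if a == 0 then nu else 1 - nu.

Lemma sum_F2 (f : 'F_2 -> R) : \sum_a f a = f 0 + f 1.
Proof.
rewrite (bigD1 0) //= (bigD1 1) //= big1 ?addr0 // => a /andP[a0 a1].
by have := F2_cases a; rewrite (negPf a0) (negPf a1).
Qed.

(** The sum over all colorings factors over the vertices: those of [s]
    contribute [weight a], the others 1. *)
Lemma prob_subset (s : {set T}) (a : 'F_2) : s \in K ->
  \sum_(eps : cochain0 K) cochain_prob nu eps * (s \subset colored eps a)%:R =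
  weight a ^+ #|s|.
Proof.
move=> sK'.
transitivity (\sum_(eps : cochain0 K) \prod_(v : vertex K)
    (weight (eps v) * ((val v \in s) ==> (eps v == a))%:R)).
  apply: eq_bigr => eps _; rewrite big_split /=; congr (_ * _).
  rewrite -natr_prod; congr (_%:R).
  have [sa|/subsetPn[x xs xa]] := boolP (s \subset colored eps a).
    rewrite big1 // => v _; case: (boolP (val v \in s)) => // /(subsetP sa).
    by move=> /coloredP[u /val_inj -> ->]; rewrite eqxx.
  have [v vx] := simplex_vertex sK sK' xs.
  have va : eps v != a by apply: contra xa => /eqP va; apply/coloredP; exists v.
  by rewrite (bigD1 v) //= vx xs /= (negPf va) mul0n.
rewrite -(bigA_distr_bigA (fun v x => weight x *
  ((val v \in s) ==> (x == a))%:R)) /=.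
transitivity (\prod_(v : vertex K) (if val v \in s then weight a else 1)).
  apply: eq_bigr => v _; rewrite sum_F2; case: ifP => vs /=.
    have /orP[/eqP->|/eqP->] := F2_cases a;
      rewrite ?eqxx /= ?mulr1 ?mulr0 ?addr0 //.
    by rewrite ?mulr0 ?add0r.
  by rewrite !mulr1 /weight eqxx /=; ring.
rewrite -big_mkcond /= prodr_const; congr (_ ^+ _).
rewrite -(card_imset _ val_inj); apply: eq_card => x; apply/imsetP/idP.
  by move=> [v vs ->].
by move=> xs; have [v vx] := simplex_vertex sK sK' xs; exists v;
  rewrite // unfold_in /= vx.
Qed.

Lemma prob_total : \sum_(eps : cochain0 K) cochain_prob nu eps = 1.
Proof.
rewrite -(bigA_distr_bigA (fun (v : vertex K) x => weight x)) /=.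
by rewrite big1 // => v _; rewrite sum_F2 /weight eqxx /=; ring.
Qed.

Lemma prob_ge0 (eps : cochain0 K) : 0 <= nu <= 1 -> 0 <= cochain_prob nu eps.
Proof. by move=> /andP[n0 n1]; apply: prodr_ge0 => v _; case: ifP => // _;
  rewrite subr_ge0. Qed.

Lemma expected_card_colored (J : {set {set T}}) k a : J \subset faces K k ->
  \sum_(eps : cochain0 K) cochain_prob nu eps *
     #|J :&: [set s : {set T} | s \subset colored eps a]|%:R =
  weight a ^+ k * #|J|%:R.
Proof.
move=> JK; transitivity (\sum_(eps : cochain0 K) \sum_(s in J)
    cochain_prob nu eps * (s \subset colored eps a)%:R).
  apply: eq_bigr => eps _; rewrite -mulr_sumr; congr (_ * _).
  rewrite -natr_sum -sum1_card big_mkcond [in RHS]big_mkcond /=; congr (_%:R).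
  by apply: eq_bigr => s _; rewrite !inE; case: (s \in J) => //=;
    case: (s \subset _).
rewrite exchange_big /= (eq_bigr (fun=> weight a ^+ k)) => [|s /(subsetP JK)].
  by rewrite sumr_const mulr_natr.
by rewrite inE => /andP[sK' /eqP <-]; apply: prob_subset.
Qed.

(** Average the deterministic bound over the two colors.  With
    [#|J| = b + #|X|] for the Betti number [b] of [K], each color of
    probability [q] contributes
    [q^(p+1) #|J| - q^(p+2) #|X| = q^(p+1) b + q^(p+1) (1 - q) #|X|]. *)
Lemma expected_betti_le (W : {set {set T}}) p :
  0 <= nu <= 1 -> (0 < p)%N -> simplicial W -> W \subset K ->
  (forall U : {set T}, cbetti 'F_2 p.+1 (induced W U) = 0%N) ->
  cbetti 'F_2 p.+1 W = 0%N ->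
  expected_betti nu p K <=
    (cbetti 'F_2 p.+2 K)%:R + 2 * (cbetti 'F_2 p.+1 K)%:R +
    nu * (1 - nu) * (nu ^+ p + (1 - nu) ^+ p) *
      ((\dim (boundaries 'F_2 p.+1 K))%:R - (\dim (boundaries 'F_2 p.+1 W))%:R).
Proof.
move=> nu01 p0 sW WK hWU hW.
have [J [X [JK XK Jc Xc HJX]]] := induced_betti_bound char2_F2 sK WK (ltn0Sn p).
pose inU eps a := [set s : {set T} | s \subset @colored T K eps a].
have H1 : expected_betti nu p K <= \sum_(eps : cochain0 K) cochain_prob nu eps *
   ((cbetti 'F_2 p.+2 K)%:R + (#|J :&: inU eps 0|%:R - #|X :&: inU eps 0|%:R)
     + (#|J :&: inU eps 1|%:R - #|X :&: inU eps 1|%:R)).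
  apply: ler_sum => eps _; apply: ler_wpM2l; first exact: prob_ge0.
  have := betti_Veps_le eps sK p0.
  have := HJX (colored eps 0) (hWU _); have := HJX (colored eps 1) (hWU _).
  have := cbetti_Sd_le char2_F2 sK (ltn0Sn p.+1).
  rewrite -/(inU eps 0) -/(inU eps 1) -!(ler_nat R) !natrD; lra.
apply: le_trans H1 _.
under eq_bigr => eps _ do rewrite !mulrDr !mulrN.
rewrite !big_split /= !sumrN -!mulr_suml prob_total mul1r.
rewrite !(expected_card_colored _ JK) !(expected_card_colored _ XK).
rewrite /weight eqxx /=.
have arith (j x zW zK bW bK : nat) :
  (j + zW = zK -> x + bW = bK -> zW - bW = 0 ->
    bW <= zW -> bK <= zK -> j = (zK - bK) + x)%N by lia.
have EJ : #|J| = (cbetti 'F_2 p.+1 K + #|X|)%N.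
  apply: arith Jc Xc hW _ _; apply/dimvS/boundaries_sub/simplicial_closed =>
    //; exact: char2_F2.
have -> : (\dim (boundaries 'F_2 p.+1 K))%:R -
  (\dim (boundaries 'F_2 p.+1 W))%:R = #|X|%:R :> R.
  by rewrite -Xc natrD addrK.
rewrite EJ natrD; set h := (cbetti 'F_2 p.+1 K)%:R; set x := #|X|%:R.
case/andP: nu01 => n0 n1.
have h0 : 0 <= h by rewrite ler0n.
have e1 : nu ^+ p.+1 <= 1 by rewrite exprn_ile1.
have e2 : (1 - nu) ^+ p.+1 <=
  1 by rewrite exprn_ile1 ?subr_ge0 // lerBlDr lerDl.
have := ler_wpM2r h0 e1; have := ler_wpM2r h0 e2; rewrite !mul1r.
rewrite !exprS; lra.
Qed.
End Expectation.

(** * Homology of packings *)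

(** The form of the packing condition that is used: no two members of [P] share
    a face with [p] vertices. *)
Definition packed (T : finType) (p : nat) (W P : {set {set T}}) :=
  [/\ simplicial W, P \subset W,
      (forall t, t \in W -> exists2 s, s \in P & t \subset s) &
      (forall s s', s \in P -> s' \in P -> s != s' -> (#|s :&: s'| < p)%N)].

Section Packed.
Variable (F : fieldType).
Hypothesis char2 : 2%N \in [pchar F].
Variables (T : finType) (p : nat) (W P : {set {set T}}).
Hypothesis packW : packed p W P.
Local Notation chain T := {ffun {set T} -> F^o}.
Local Notation delta := (@delta F _).
Local Notation bd := (bd F _).
Local Notation chains := (@chains F _).
Local Notation linext := (@linext F _ _).
Local Notation cone := (@cone F _).

(** A face with at least [p] vertices lies in only one member of [P], its owner,
    and so do its facets when it has more than [p].  Coning every face over a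
    vertex of its owner in [U] therefore contracts the cycles. *)
Lemma packed_acyclic U k : (p < k)%N -> cbetti F k (induced W U) = 0%N.
Proof.
move=> pk; have [sW PW cover sep] := packW.
set X := induced W U.
apply/eqP; rewrite subn_eq0; apply: dimvS; apply/subvP => z /cyclesP[zX bz].
have [X0|[t0 t0X]] := set_0Vmem (faces X k).
  have -> : z = 0.
    by apply/ffunP => s; rewrite ffunE; move/chainsP: zX; apply; rewrite X0 inE.
  exact: mem0v.
have k0 : (0 < k)%N by lia.
have [x0 _] : exists x, x \in t0.
  by apply/set0Pn; rewrite -card_gt0; move: t0X;
    rewrite inE => /andP[_ /eqP ->].
pose owner (t : {set T}) := odflt set0 [pick s in P | t \subset s].
have ownerP (t s : {set T}) : s \in P -> t \subset s -> (p <= #|t|)%N ->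
  owner t = s.
  move=> sP ts tp; rewrite /owner;
    case: pickP => [s' /andP[s'P ts']|/(_ s)] /=; last first.
    by rewrite sP ts.
  apply/eqP; apply: contraTT tp => /(sep _ _ s'P sP); rewrite -ltnNge.
  by apply: leq_ltn_trans; apply: subset_leq_card; rewrite subsetI ts' ts.
pose v (t : {set T}) := odflt x0 [pick x in owner t :&: U].
pose h (t : {set T}) : chain T := cone (v t) (delta t).
have hX t : t \in faces X k -> h t \in chains (faces X k.+1).
  rewrite !inE => /andP[/andP[tW tU] /eqP tk].
  have [s sP ts] := cover t tW.
  have Eo : owner t = s by apply: ownerP => //; lia.
  have [x xt] : exists x, x \in t by apply/set0Pn; rewrite -card_gt0 tk.
  have vsU : v t \in s :&: U.
    rewrite /v Eo; case: pickP => [//|/(_ x)] /=.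
    by rewrite inE (subsetP ts) // (subsetP tU).
  have [vt|vt] := boolP (v t \in t).
    have -> : h t = 0; last exact: mem0v.
    apply/ffunP => u; rewrite /h coneE !ffunE; case: ifP => // vu.
    by case: eqP => // E; have := setD11 (v t) u; rewrite E vt.
  rewrite /h cone_delta // delta_chains !inE cardsU1 vt tk eqxx andbT.
  case/setIP: vsU => vs vU; rewrite !subUset !sub1set vU tU !andbT.
  apply: (simplicialE sW (subsetP PW s sP));
    last by rewrite subUset sub1set vs ts.
  by apply/set0Pn; exists (v t); rewrite setU11.
have hbd t : t \in faces X k -> bd (h t) = delta t + linext h (bd (delta t)).
  rewrite !inE => /andP[/andP[tW tU] /eqP tk].
  have [s sP ts] := cover t tW.
  have Eo : owner t = s by apply: ownerP => //; lia.
  rewrite /h bd_cone //; congr (_ + _); rewrite bd_delta_sum !linear_sum /=.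
  apply: eq_bigr => x xt; rewrite linext_delta /h /v Eo (ownerP _ s) //.
    exact: subset_trans (subsetDl _ _) ts.
  by move: tk; rewrite (cardsD1 x) xt; lia.
have hz : bd (linext h z) = z + linext h (bd z).
  rewrite {1 3}(chains_sum zX) !linear_sum /= {2}(chains_sum zX) -big_split /=.
  apply: eq_bigr => t tX; rewrite !linearZ /= -scalerDr; congr (_ *: _).
  by rewrite linext_delta hbd.
rewrite bz linear0 addr0 in hz; rewrite -hz; apply: memv_img.
exact: linext_chains zX hX.
Qed.

Lemma packed_cbetti k : (p < k)%N -> cbetti F k W = 0%N.
Proof.
have -> : W = induced W setT by apply/setP => s; rewrite inE subsetT andbT.
exact: packed_acyclic.
Qed.
End Packed.

Section Alternating.
Variables (R : realType) (T : finType) (K : {set {set T}}).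
Hypothesis sK : simplicial K.

Lemma height_faces m : (height K <= m)%N -> faces K m.+1 = set0.
Proof.
move=> Km; apply/setP => s; rewrite !inE; apply/negP => /andP[sK' /eqP sm].
by have := @leq_bigmax_cond _ (mem K) (fun s : {set T} => #|s|) s sK';
  rewrite -/(height K) sm; lia.
Qed.

Lemma dim_boundaries0 m : (height K <= m)%N -> \dim (boundaries 'F_2 m K) = 0%N.
Proof.
move=> Km; rewrite /boundaries (height_faces Km);
  have := limg_ker_dim (bd 'F_2 T) (chains 'F_2 set0).
by rewrite dim_chains cards0 => /eqP; rewrite addn_eq0 => /andP[_ /eqP].
Qed.

Lemma fvec_sub_betti i : (0 < i)%N ->
  (fvec K i)%:R - (betti K i)%:R =
  (\dim (boundaries 'F_2 i K))%:R + (\dim (boundaries 'F_2 i.+1 K))%:R :> R.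
Proof.
move=> i0; rewrite betti_cbetti // /fvec -(dim_cycles 'F_2) /cbetti.
have := dimvS (boundaries_sub char2_F2 (simplicial_closed sK (ltn0Sn i))).
by move=> le; rewrite natrB // natrD; ring.
Qed.

(** Telescoping: the difference of face and Betti numbers in degree [i] is the
    sum of the ranks of the two boundary maps at that degree. *)
Lemma alternating_sum p m : (p < m)%N ->
  \sum_(p.+1 <= i < m) (-1) ^+ (i.+1 - p) * ((fvec K i)%:R - (betti K i)%:R) =
  (\dim (boundaries 'F_2 p.+1 K))%:R +
    (-1) ^+ (m - p) * (\dim (boundaries 'F_2 m K))%:R :> R.
Proof.
elim: m => // m IH; rewrite ltnS leq_eqVlt => /orP[/eqP->|pm].
  by rewrite big_geq // subSnn expr1 mulN1r subrr.
rewrite big_nat_recr //= IH // fvec_sub_betti; last by lia.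
by rewrite subSn ?(ltnW pm) // exprS; ring.
Qed.

Lemma rank_alternating p m : (p < m)%N -> (height K <= m)%N ->
  (\dim (boundaries 'F_2 p.+1 K))%:R =
  \sum_(p.+1 <= i < m)
    (-1) ^+ (i.+1 - p) * ((fvec K i)%:R - (betti K i)%:R) :> R.
Proof. by move=> pm hm; rewrite alternating_sum // (dim_boundaries0 hm) mulr0
  addr0. Qed.

Lemma alternating_height p :
  \sum_(p.+1 <= i < height K) (-1) ^+ (i.+1 - p) *
    ((fvec K i)%:R - (betti K i)%:R)
  = (\dim (boundaries 'F_2 p.+1 K))%:R :> R.
Proof.
have [h|h] := ltnP p (height K); first by rewrite -rank_alternating.
by rewrite big_geq ?dim_boundaries0 // leqW.
Qed.
End Alternating.

Lemma packed_M (R : realType) (nu : R) (T : finType) p (W P : {set {set T}}) :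
  (0 < p)%N -> packed p W P ->
  M_ p nu W = nu * (1 - nu) * (nu ^+ p + (1 - nu) ^+ p) *
    (\dim (boundaries 'F_2 p.+1 W))%:R.
Proof.
move=> p0 pW; have [sW _ _ _] := pW;
  rewrite /M_ alternating_height // betti_cbetti //.
by rewrite (packed_cbetti char2_F2 pW) // mulr0 add0r.
Qed.

Lemma packed_rank (R : realType) (T : finType) p m (W P : {set {set T}}) :
  (0 < p)%N -> packed p W P -> (p < m)%N -> (height W <= m)%N ->
  (\dim (boundaries 'F_2 p.+1 W))%:R =
  \sum_(p.+1 <= i < m) (-1) ^+ (i.+1 - p) * (fvec W i)%:R :> R.
Proof.
move=> p0 pW pm hm; have [sW _ _ _] := pW;
  rewrite (rank_alternating R sW pm hm).
rewrite !big_nat; apply: eq_bigr => i /andP[pi im]; rewrite betti_cbetti //;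
  last by lia.
by rewrite (packed_cbetti char2_F2 pW) ?subr0 //; lia.
Qed.

(** * Face numbers of subdivisions *)

Section FaceNumbers.
Local Open Scope nat_scope.

(** The number of flags of [k + 1] nonempty sets whose greatest element is a
    given set with [m] elements, provided [m > 0]: remove it, and sum over the
    size [j] of the next one. *)
Fixpoint flag_count (k m : nat) : nat :=
  if k is k'.+1 then \sum_(j < m | 0 < j) 'C(m, j) * flag_count k' j else 1.

Lemma flag_count_small k m : m <= k -> 0 < m -> flag_count k m = 0.
Proof.
elim: k m => [|k IH] m mk m0; first by lia.
rewrite [flag_count _ _]/= big1 // => j j0; rewrite IH ?muln0 //;
  have := ltn_ord j; lia.
Qed.

Lemma flag_count_diag k : flag_count k k.+1 = k.+1`!.
Proof.
elim: k => // k IH; rewrite [LHS]/= (bigD1 (Ordinal (ltnSn k.+1))) //=.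
rewrite IH big1 ?addn0 => [|j /andP[j0]].
  by rewrite binSn factS.
rewrite -(inj_eq val_inj) /= => jk; rewrite flag_count_small ?muln0 //.
by have := ltn_ord j; lia.
Qed.

Lemma leq_height (T : finType) (K : {set {set T}}) s : s \in K -> #|s| <=
  height K.
Proof. exact: (@leq_bigmax_cond _ (mem K) (fun s : {set T} => #|s|) s). Qed.

Lemma height_le (T : finType) (K : {set {set T}}) m :
  (forall s, s \in K -> #|s| <= m) -> height K <= m.
Proof. by move=> H; apply/bigmax_leqP. Qed.

Section Counting.
Variable T : finType.
Implicit Types (s t : {set T}) (c : {set {set T}}) (K : {set {set T}}).

Definition flags_to k s :=
  [set c | [&& isflag c, set0 \notin c, top c == s & #|c| == k.+1]].

Lemma isflag_top_proper c t : isflag c -> t \in c :\ top c -> t \proper top c.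
Proof.
move=> fc; rewrite in_setD1 => /andP[tt tc]; rewrite properEneq tt.
exact: sub_top.
Qed.

(** Removing the greatest element of a flag, as a bijection. *)
Lemma flags_to_setU1 k s t : t \proper s -> t != set0 ->
  [set c in flags_to k.+1 s | top (c :\ s) == t] =
  (fun c => s |: c) @: flags_to k t.
Proof.
move=> ts t0; apply/setP => c; apply/idP/imsetP.
  rewrite !inE => /andP[/and4P[fc n0 /eqP tc /eqP ck] tt].
  have c0 : c != set0 by rewrite -card_gt0 ck.
  have sc : s \in c by rewrite -tc top_mem.
  exists (c :\ s); last by rewrite setD1K.
  rewrite inE tt (isflagS (subsetDl _ _) fc) inE negb_and n0 orbT /=.
  by move: ck; rewrite (cardsD1 s) sc add1n => -[->].
move=> [c' c'F ->]; move: c'F;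
  rewrite [_ \in flags_to _ _]inE => /and4P[fc n0 /eqP tc /eqP ck].
have sub u : u \in c' -> u \proper s.
  by move=> uc; apply: sub_proper_trans ts; rewrite -tc sub_top.
have sc' : s \notin c' by apply/negP => /sub; rewrite properxx.
have s0 : s != set0 by apply: contra t0 => /eqP s0;
  rewrite -subset0 -s0 proper_sub.
rewrite !inE setU1K // tc eqxx andbT cardsU1 sc' ck eqxx andbT negb_or n0 andbT.
rewrite eq_sym s0 isflagU1 //= => [|u /sub /proper_sub //].
rewrite eqEsubset; apply/andP; split; last by rewrite sub_top ?setU11.
apply/bigcupsP => u; rewrite in_setU1 => /orP[/eqP-> //|/sub /proper_sub //].
Qed.

Lemma sum_proper_subsets (g : nat -> nat) s : s != set0 ->
  \sum_(t : {set T} | (t \proper s) && (t != set0)) g #|t| =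
  \sum_(j < #|s| | 0 < j) 'C(#|s|, j) * g j.
Proof.
rewrite -card_gt0; move Em: #|s| => m; case: m Em => // m Em _.
rewrite (partition_big (fun t : {set T} => (inord #|t| : 'I_m.+1))
  (fun j => 0 < j)) /=.
  apply: eq_bigr => j j0; rewrite -[X in 'C(X, _)]Em -cards_draws
    -sum_nat_const.
  apply: eq_big => [t|t /andP[/andP[ts _] /eqP <-]]; last first.
    by rewrite inordK // -Em proper_card.
  rewrite inE; apply/idP/idP.
    move=> /andP[/andP[ts t0] /eqP <-]; rewrite proper_sub //= inordK //.
    by rewrite -Em proper_card.
  move=> /andP[ts /eqP tj]; rewrite properEcard ts tj Em ltn_ord -card_gt0 tj
    j0 /=.
  by apply/eqP/val_inj; rewrite /= inordK.
move=> t /andP[ts t0]; rewrite inordK ?card_gt0 //.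
by rewrite -Em proper_card.
Qed.

Lemma card_flags_to k s : s != set0 -> #|flags_to k s| = flag_count k #|s|.
Proof.
elim: k s => [|k IH] s s0.
  rewrite /= (_ : flags_to 0 s = [set [set s]]) ?cards1 //.
  apply/setP => c; rewrite !inE;
    apply/idP/eqP => [/and4P[_ _ /eqP tc /cards1P[u cu]]|->].
    by rewrite cu; congr [set _]; rewrite -tc cu /top big_set1.
  rewrite /top big_set1 cards1 !eqxx inE eq_sym s0 !andbT /=.
  by apply/flagP => a b; rewrite !inE => /eqP -> /eqP ->; rewrite subxx.
rewrite -sum1_card (partition_big (fun c => top (c :\ s))
  (fun t => (t \proper s) && (t != set0))).
  rewrite [RHS]/= -(sum_proper_subsets _ s0); apply: eq_bigr => t /andP[ts t0].
  rewrite -IH // sum1_card.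
  rewrite (_ : #|_| = #|[set c in flags_to k.+1 s | top (c :\ s) == t]|);
    last first.
    by apply: eq_card => c; rewrite [RHS]inE.
  rewrite flags_to_setU1 // card_in_imset // => c c'; rewrite !inE.
  move=> /and4P[_ _ /eqP tc _] /and4P[_ _ /eqP tc' _] E.
  have H d : top d = t -> s \notin d.
    move=> td; apply/negP => sd; move: ts; rewrite properE => /andP[_ /negP[]].
    by rewrite -td sub_top.
  by rewrite -(setU1K (H c tc)) E setU1K // H.
move=> c; rewrite inE => /and4P[fc n0 /eqP tc /eqP ck].
have cs0 : c :\ s != set0.
  rewrite -card_gt0; move: ck; rewrite (cardsD1 s); move: #|_| => x;
    case: (s \in c) => /=; lia.
have tcs := top_mem (isflagS (subsetDl c [set s]) fc) cs0.
rewrite -{1 2}tc isflag_top_proper //=; last by rewrite tc.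
apply/eqP => t0; case/negP: n0; rewrite -t0.
by move: tcs; rewrite in_setD1 => /andP[].
Qed.

Lemma fvec_Sd K k : simplicial K ->
  fvec (Sd K) k = \sum_(s in K) flag_count k #|s|.
Proof.
move=> sK; rewrite /fvec -sum1_card (partition_big (@top T) (mem K)) /=.
  apply: eq_bigr => s sK'; have s0 := simplex_neq0 sK sK'.
  rewrite -card_flags_to // sum1_card; apply: eq_card => c.
  rewrite [RHS]inE [LHS]unfold_in /= inE Sd_flags; apply/idP/idP.
    move=> /andP[/andP[/order_complexP[c0 cK fc] ->] ->]; rewrite fc /= andbT.
    by apply/negP => /cK; apply/negP; case/andP: sK.
  move=> /and4P[fc n0 /eqP tc ck]; rewrite ck tc eqxx !andbT.
  apply/order_complexP; split=> //; first by rewrite -card_gt0 (eqP ck).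
  move=> t tc'; apply: (simplicialE sK sK'); last by rewrite -tc sub_top.
  by apply: contraNneq n0 => <-.
move=> c; rewrite inE Sd_flags => /andP[/order_complexP[c0 cK fc] _].
exact/cK/top_mem.
Qed.

Lemma fvec_Sd_sum K k m : simplicial K -> height K <= m ->
  fvec (Sd K) k = \sum_(j < m) flag_count k j.+1 * fvec K j.
Proof.
move=> sK hK; rewrite fvec_Sd //; case: m hK => [|m] hK.
  rewrite big_ord0; apply: big1 => s sK'; exfalso.
  by have := leq_height sK'; have := simplex_neq0 sK sK'; rewrite -card_gt0;
    lia.
have P s : s \in K -> (0 < #|s|) && (#|s| <= m.+1).
  by move=> sK'; rewrite card_gt0 (simplex_neq0 sK)
    // (leq_trans (leq_height sK')).
rewrite (partition_big (fun s : {set T} => (inord #|s|.-1 : 'I_m.+1)) predT)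
  //=.
apply: eq_bigr => j _; rewrite mulnC /fvec -sum_nat_const.
apply: eq_big => [s|s /andP[sK' /eqP <-]]; last first.
  by have := P s sK' => /andP[s0 sm]; rewrite inordK ?prednK //; lia.
rewrite inE; apply/andP/andP => -[sK' /eqP E]; split => //;
  have /andP[s0 sm] := P s sK'.
  by rewrite -E inordK ?prednK //; lia.
by apply/eqP/val_inj; rewrite /= E inordK ?ltn_ord.
Qed.

Lemma height_Sd K : simplicial K -> height (Sd K) <= height K.
Proof.
move=> sK; apply: height_le => c cS; rewrite leqNgt; apply/negP => lt.
case Ec: #|c| lt => [|k] // lt.
have : 0 < fvec (Sd K) k by rewrite card_gt0; apply/set0Pn; exists c;
  rewrite !inE Ec eqxx andbT; move: cS; rewrite inE.
rewrite fvec_Sd // big1 // => s sK'; apply: flag_count_small.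
  by apply: leq_trans (leq_height sK') _.
by rewrite card_gt0 (simplex_neq0 sK).
Qed.
End Counting.

Lemma simplicial_Sd (T : finType) (K : {set {set T}}) : simplicial (Sd K).
Proof. by rewrite Sd_flags simplicial_order_complex. Qed.

Section Iterated.
Variables (T : finType) (K : {set {set T}}).
Hypothesis sK : simplicial K.

Lemma simplicial_iterSd d : simplicial (iterSd K d).
Proof. by case: d => [|d] //; apply: simplicial_Sd. Qed.

Lemma height_iterSd d : height (iterSd K d) <= height K.
Proof.
elim: d => // d IH; apply: leq_trans IH; apply: height_Sd.
exact: simplicial_iterSd.
Qed.

Lemma cbetti_iterSd (F : fieldType) d k : 2 \in [pchar F]%R -> 0 < k ->
  cbetti F k (iterSd K d) <= cbetti F k K.
Proof.
move=> char2 k0; elim: d => // d IH; apply: leq_trans IH;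
  apply: cbetti_Sd_le => //.
exact: simplicial_iterSd.
Qed.
End Iterated.

End FaceNumbers.

(** * Limits of triangular recursions *)

Section Limits.
Local Open Scope classical_set_scope.
Variable R : realType.

(** The distance to the fixed point [c0 / (1 - r)] is multiplied by [r] at each
    step, up to an error that tends to 0. *)
Lemma cvg_contraction (r c0 : R) (x c : nat -> R) : 0 <= r < 1 ->
  c @ \oo --> c0 -> (forall d, x d.+1 = r * x d + c d) ->
  x @ \oo --> c0 / (1 - r).
Proof.
move=> /andP[r0 r1] cc0 xE; set L := c0 / (1 - r).
have LE : L = r * L + c0 by rewrite /L; field; lra.
apply/cvgrPdist_le => eps eps0.
have e2 : 0 < eps * (1 - r) / 2 by rewrite divr_gt0 ?mulr_gt0 ?subr_gt0.
have /cvgrPdist_le/(_ _ e2)[N _ HN] := cc0.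
(* the errors after [N], each at most [eps (1 - r) / 2], add up to a geometric
   series with sum at most [eps / 2] *)
have H k : `|L - x (N + k)%N| <= eps / 2 + r ^+ k * `|L - x N|.
  elim: k => [|k IH]; first by rewrite addn0 expr0 mul1r lerDr divr_ge0 // ltW.
  rewrite addnS xE {1}LE.
  have -> : r * L + c0 - (r * x (N + k)%N + c (N + k)%N) =
    r * (L - x (N + k)%N) + (c0 - c (N + k)%N) by ring.
  apply: le_trans (ler_normD _ _) _; rewrite normrM (ger0_norm r0) exprS.
  have := HN (N + k)%N (leq_addr _ _); have := ler_wpM2l r0 IH => /=; lra.
have rc : (fun k => r ^+ k * `|L - x N|) @ \oo --> (0 : R).
  rewrite -(mul0r `|L - x N|); apply: cvgMl; apply: cvg_expr.
  by rewrite ger0_norm.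
have e3 : 0 < eps / 2 by rewrite divr_gt0.
have /cvgrPdist_le/(_ _ e3)[M _ HM] := rc.
exists (N + M)%N => // d /= dNM; have := H (d - N)%N; rewrite subnKC;
  last by lia.
have /HM : (M <= d - N)%N by lia.
rewrite /= sub0r normrN => h1 h2; apply: le_trans h2 _.
have := le_trans (ler_norm _) h1; lra.
Qed.

Lemma cvg_sumr (I : Type) (s : seq I) (P : pred I) (f : I -> nat -> R)
  (l : I -> R) :
  (forall i, P i -> f i @ \oo --> l i) ->
  (fun d => \sum_(i <- s | P i) f i d) @ \oo --> \sum_(i <- s | P i) l i.
Proof.
move=> H; elim: s => [|i s IH].
  by rewrite big_nil; under eq_fun => d do rewrite big_nil; apply: cvg_cst.
rewrite big_cons; under eq_fun => d do rewrite big_cons.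
by case: ifP => // Pi; apply: cvgD => //; apply: H.
Qed.

(** Descending induction on [k]: once the sequences of greater index converge,
    the one of index [k] satisfies a contracting recursion.  The limits depend
    on the matrix only, not on the sequences. *)
Lemma cvg_triangular (n : nat) (m : nat -> nat -> R) :
  (forall k j, (j < k <= n)%N -> m k j = 0) -> m n n = 1 ->
  (forall k, (k < n)%N -> 0 <= m k k < 1) ->
  exists l : nat -> R, forall a : nat -> nat -> R, a n 0%N = 1 ->
    (forall k d, (k <= n)%N -> a k d.+1 = \sum_(j < n.+1) m k j * a j d) ->
    forall k, (k <= n)%N -> a k @ \oo --> l k.
Proof.
move=> m0 m1 mr.
suff H i : (i <= n)%N -> exists l : nat -> R, forall a : nat -> nat ->
  R, a n 0%N = 1 ->
    (forall k d, (k <= n)%N -> a k d.+1 = \sum_(j < n.+1) m k j * a j d) ->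
    forall k, (n - i <= k <= n)%N -> a k @ \oo --> l k.
  by have [l Hl] := H n (leqnn _); exists l => a a1 aE k kn; apply: Hl;
    rewrite // subnn.
elim: i => [_|i IH ilt].
  exists (fun=> 1) => a a1 aE k; rewrite subn0 -eqn_leq => /eqP <-.
  suff -> : a n = fun=> 1 by apply: cvg_cst.
  apply/funext; elim=> // d IH; rewrite aE // (bigD1 ord_max) //= m1 IH mul1r.
  rewrite big1 ?addr0 // => j jn; rewrite m0 ?mul0r // leqnn andbT.
  by have := ltn_ord j; rewrite ltnS leq_eqVlt -(inj_eq val_inj) /= in jn *;
    rewrite (negPf jn).
have [l Hl] := IH (ltnW ilt).
set k0 := (n - i.+1)%N.
have k0n : (k0 < n)%N by rewrite /k0; lia.
pose c0 := \sum_(j < n.+1 | (k0 < j)%N) m k0 j * l j.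
exists (fun k => if k == k0 then c0 / (1 - m k0 k0) else l k) => a a1 aE k
  /andP[kge kn].
case: eqP => [->|kk0]; last by apply: Hl => //; rewrite kn andbT;
  move: kk0 kge; rewrite /k0; lia.
apply: (@cvg_contraction (m k0 k0) c0 _
  (fun d => \sum_(j < n.+1 | (k0 < j)%N) m k0 j * a j d)).
- exact: mr.
- apply: cvg_sumr => j kj; apply: cvgMr; apply: Hl => //.
  by have := ltn_ord j; move: kj; rewrite /k0; lia.
move=> d; rewrite aE ?(ltnW k0n) //.
have k0n1 : (k0 < n.+1)%N by lia.
rewrite (bigD1 (Ordinal k0n1)) //=; congr (_ + _).
rewrite [RHS]big_mkcond [LHS]big_mkcond /=; apply: eq_bigr => j _.
rewrite -(inj_eq val_inj) /=; case: ltngtP => //= jk.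
by rewrite m0 ?mul0r // jk ltnW.
Qed.
End Limits.

(** * Copies of a packing in every top simplex *)

Section Functoriality.
Local Open Scope nat_scope.

Lemma SdI (T : finType) (A B : {set {set T}}) : Sd (A :&: B) = Sd A :&: Sd B.
Proof. by apply/setP => c; rewrite !inE subsetI; do !case: (_ \subset _);
  rewrite ?andbF ?andbb // andbACA andbb. Qed.

Lemma iterSdI (T : finType) (A B : {set {set T}}) d :
  iterSd (A :&: B) d = iterSd A d :&: iterSd B d.
Proof. by elim: d => //= d ->; rewrite SdI. Qed.

Lemma iterSdS (T : finType) (A B : {set {set T}}) d :
  A \subset B -> iterSd A d \subset iterSd B d.
Proof. by move/setIidPl => <-; rewrite iterSdI subsetIr. Qed.

Definition image_complex (A B : finType) (f : A -> B) (K : {set {set A}}) :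
  {set {set B}} :=
  [set f @: s | s : {set A} in K].

Lemma imset_subset_inj (A B : finType) (f : A -> B) (s t : {set A}) : injective
  f ->
  (f @: s \subset f @: t) = (s \subset t).
Proof.
move=> fI; apply/idP/idP => [/subsetP H|]; last exact: imsetS.
by apply/subsetP => x xs; have := H _ (imset_f f xs); rewrite mem_imset.
Qed.

Lemma Sd_image (A B : finType) (f : A -> B) (K : {set {set A}}) : injective f ->
  Sd (image_complex f K) = image_complex (fun s : {set A} => f @: s) (Sd K).
Proof.
move=> fI; have fI' : injective (fun s : {set A} => f @: s) by apply: imset_inj.
apply/setP => c; rewrite Sd_flags; apply/order_complexP/imsetP.
  move=> [c0 cK fc]; exists [set s in K | f @: s \in c]; last first.
    apply/setP => u; apply/idP/imsetP => [uc|[s]].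
      have /imsetP[s sK Eu] := cK u uc.
      by exists s => //; rewrite inE sK -Eu.
    by rewrite inE => /andP[_ ? ->].
  rewrite Sd_flags; apply/order_complexP; split.
  - have /set0Pn[u uc] := c0; have /imsetP[s sK Eu] := cK u uc.
    by apply/set0Pn; exists s; rewrite inE sK -Eu.
  - by move=> s; rewrite inE => /andP[].
  apply/flagP => s t; rewrite !inE => /andP[_ sc] /andP[_ tc].
  by have := flagP _ fc _ _ sc tc; rewrite !imset_subset_inj.
move=> [c']; rewrite Sd_flags => /order_complexP[c0 cK fc] ->; split.
- have /set0Pn[u uc] := c0; apply/set0Pn; exists (f @: u); exact: imset_f.
- by move=> s /imsetP[u uc ->]; apply: imset_f; apply: cK.
apply/flagP => s t /imsetP[s' sc ->] /imsetP[t' tc ->].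
by rewrite !imset_subset_inj // (flagP _ fc).
Qed.

(** The barycenters of a subdivision are sets of vertices of the previous one,
    so a map of vertices acts on them by taking images [d] times. *)
Section Lift.
Variables (A B : finType) (g : A -> B).
Fixpoint SdT_map (d : nat) : SdT A d -> SdT B d :=
  if d is d'.+1 return SdT A d -> SdT B d
  then fun c : {set SdT A d'} => @SdT_map d' @: c else g.
Arguments SdT_map d : clear implicits.

Lemma SdT_map_inj d : injective g -> injective (SdT_map d).
Proof. by move=> gI; elim: d => //= d IH; apply: imset_inj. Qed.
End Lift.
Arguments SdT_map {A B} g d _.

Lemma iterSd_image (A B : finType) (g : A -> B) (K : {set {set A}}) d :
  injective g ->
  iterSd (image_complex g K) d = image_complex (SdT_map g d) (iterSd K d).
Proof. by move=> gI; elim: d => //= d ->; rewrite Sd_image //;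
  apply: SdT_map_inj. Qed.

(** The vertex types of the two iterated subdivisions are equal but not
    convertible for a variable [e]; the property [Q] absorbs the transport. *)
Lemma iterSd_iterSd (Q : forall T : finType, {set {set T}} -> Prop)
    (T : finType) (K : {set {set T}}) d e :
  Q _ (iterSd (iterSd K d) e) -> Q _ (iterSd K (e + d)).
Proof.
elim: e Q => // e IH Q H.
exact: (IH (fun T' K' => Q _ (Sd K'))).
Qed.

Section Copies.
Variables (n : nat) (T : finType) (K : {set {set T}}).
Hypothesis sK : simplicial K.

Lemma parametrization (s : {set T}) : s \in faces K n.+1 ->
  exists g : {ffun 'I_n.+1 -> T}, injective g /\ g @: [set: 'I_n.+1] = s.
Proof.
rewrite inE => /andP[_ /eqP sn].
pose g : {ffun 'I_n.+1 -> T} := [ffun i => enum_val (cast_ord (esym sn) i)].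
have gI : injective g by move=> i j;
  rewrite !ffunE => /enum_val_inj/cast_ord_inj.
exists g; split => //; apply/eqP;
  rewrite eqEcard card_imset // cardsT card_ord sn leqnn andbT.
by apply/subsetP => x /imsetP[i _ ->]; rewrite ffunE enum_valP.
Qed.

Lemma sub_imset (A B : finType) (f : A -> B) (t : {set A}) (u : {set B}) :
  u \subset f @: t -> exists2 t' : {set A}, t' \subset t & u = f @: t'.
Proof.
move=> /subsetP ut; exists [set x in t | f x \in u].
  by apply/subsetP => x; rewrite inE => /andP[].
apply/setP => y; apply/idP/imsetP => [yu|[x]];
  last by rewrite inE => /andP[_ ? ->].
by have /imsetP[x xt yx] := ut y yu; exists x => //; rewrite inE xt -yx.
Qed.

Lemma simplicial_image (A B : finType) (f : A -> B) (X : {set {set A}}) :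
  simplicial X -> simplicial (image_complex f X).
Proof.
move=> sX; apply/andP; split.
  apply/negP => /imsetP[s sX' /esym/eqP]; rewrite imset_eq0.
  exact/negP/(simplex_neq0 sX).
apply/forall_inP => u /imsetP[s sX' ->]; apply/forallP => t;
  apply/implyP => /andP[t0].
move=> /sub_imset[t' ts E]; rewrite E imset_f //;
  apply: (simplicialE sX sX') => //.
by move: t0; rewrite E imset_eq0.
Qed.

Lemma simplicial_Delta : simplicial (Delta n).
Proof.
apply/andP; split; first by rewrite inE eqxx.
apply/forall_inP => s _; apply/forallP => t; apply/implyP => /andP[t0 _].
by rewrite inE.
Qed.

(** One copy of [L] in each simplex of [K] of dimension [n], by a
    parametrization of its vertices.  Two copies in different simplices can
    only meet in the subdivided boundary of the model simplex, where the faces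
    of a packing have fewer than [p] vertices. *)
Lemma packed_copies p d (L : {set {set (SdT 'I_n.+1 d)}}) : 0 < p ->
  L \in packings n p d ->
  exists W P, [/\ packed p W P, W \subset iterSd K d &
    forall k, p <= k -> #|faces W k| = #|faces K n.+1| * #|faces L k|].
Proof.
move=> p0; rewrite inE => /and3P[sL LD
  /existsP[S /and4P[SL /forall_inP cover /forall_inP sep /forall_inP bnd]]].
set Fc := faces K n.+1.
have [F0|[s0 s0F]] := set_0Vmem Fc.
  exists set0, set0; split; last first.
  - move=> k _; rewrite F0 cards0 mul0n; apply/eqP; rewrite cards_eq0.
    by apply/eqP/setP => s; rewrite !inE.
  - exact: sub0set.
  split; [|exact: sub0set|by move=> t; rewrite inE|by move=> s; rewrite inE].
  by apply/andP; split; [rewrite inE|apply/forall_inP => s; rewrite inE].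
have [g0 _] := parametrization s0F.
pose g s := odflt g0 [pick g : {ffun 'I_n.+1 -> T} | injectiveb g & g @:
  [set: 'I_n.+1] == s].
have gP s : s \in Fc -> injective (g s) /\ g s @: [set: 'I_n.+1] = s.
  move=> sF; rewrite /g; case: pickP => [h /andP[/injectiveP hI /eqP hs] //|].
  by have [h [hI hs]] := parametrization sF => /(_ h);
    rewrite hs eqxx andbT => /injectiveP[].
pose G s := SdT_map (g s) d.
have GI s : s \in Fc -> injective (G s) by move=> /gP[gI _]; apply: SdT_map_inj.
pose full s := image_complex (g s) (Delta n).
have fullE s : s \in Fc -> iterSd (full s) d = image_complex (G s)
  (iterSd (Delta n) d).
  by move=> /gP[gI _]; apply: iterSd_image.
have inK s t : s \in Fc -> t \in L -> G s @: t \in iterSd (full s) d.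
  by move=> sF tL; rewrite fullE // imset_f // (subsetP LD).
have fullK s : s \in Fc -> full s \subset K.
  move=> sF; have [_ gs] := gP s sF; apply/subsetP => u /imsetP[v];
    rewrite inE => v0 ->.
  move: sF; rewrite inE => /andP[sK' _]; apply: (simplicialE sK sK').
    by rewrite imset_eq0.
  have : g s @: v \subset g s @: [set: 'I_n.+1] by apply/imsetS/subsetT.
  by rewrite gs.
have sfull s : simplicial (iterSd (full s) d).
  exact/simplicial_iterSd/simplicial_image/simplicial_Delta.
have far s s' t : s \in Fc -> s' \in Fc -> s != s' -> t \in L -> p <= #|t| ->
    G s @: t \notin iterSd (full s') d.
  move=> sF s'F ss' tL tp; apply/negP => ts'.
  have [gI gs] := gP s sF; have [_ gs'] := gP s' s'F.
  have : G s @: t \in iterSd (full s :&: full s') d by rewrite iterSdI inE inK.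
  have sub : full s :&: full s' \subset image_complex (g s) (bdDelta n).
    apply/subsetP => u /setIP[/imsetP[v v0 ->] /imsetP[v' _ E]]; apply: imset_f.
    rewrite inE v0 /=; apply: contra ss' => /eqP vT.
    move: sF s'F; rewrite !inE => /andP[_ /eqP sn] /andP[_ /eqP sn'].
    rewrite eqEcard sn sn' leqnn andbT.
    have : g s' @: v' \subset g s' @: [set: 'I_n.+1] by apply/imsetS/subsetT.
    by rewrite -E vT gs gs'.
  move/(subsetP (iterSdS _ sub)); rewrite iterSd_image // => /imsetP[t' t'B].
  move/(imset_inj (GI s sF)) => tt'; rewrite -{}tt' in t'B.
  have /exists_inP[s1 s1S ts1] := cover t tL.
  have := bnd s1 s1S; rewrite /dimc ltrD2r ltz_nat ltnNge; case/negP.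
  apply: leq_trans tp _; apply: (@leq_height _ _ t).
  by rewrite inE t'B.
pose im (X : {set {set (SdT 'I_n.+1 d)}}) :=
  (fun x : {set T} * {set (SdT 'I_n.+1 d)} => G x.1 @: x.2) @: setX Fc X.
have imP (X : {set {set (SdT 'I_n.+1 d)}}) (u : {set SdT T d}) : reflect
  (exists s t, [/\ s \in Fc, t \in X & u = G s @: t]) (u \in im X).
  apply: (iffP imsetP) => [[[s t]]|[s [t [sF tX ->]]]].
    by rewrite inE /= => /andP[sF tX] ->; exists s, t.
  by exists (s, t); rewrite // inE /= sF.
have sW : simplicial (im L).
  apply/andP; split.
    apply/negP => /imP[s [t [_ tL /esym/eqP]]]; rewrite imset_eq0.
    exact/negP/(simplex_neq0 sL).
  apply/forall_inP => u /imP[s [t [sF tL ->]]]; apply/forallP => v.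
  apply/implyP => /andP[v0 /sub_imset[t' t't E]]; apply/imP; exists s, t';
    split=> //.
  by apply: (simplicialE sL tL) => //; move: v0; rewrite E imset_eq0.
exists (im L), (im S); split.
- split => //.
  + apply/subsetP => u /imP[s [t [sF tS ->]]]; apply/imP; exists s, t;
    split=> //.
    exact: (subsetP SL).
  + move=> u /imP[s [t [sF tL ->]]]; have /exists_inP[s1 s1S ts1] := cover t tL.
    by exists (G s @: s1); [apply/imP; exists s, s1|apply: imsetS].
  move=> u u' /imP[s [t [sF tS ->]]] /imP[s' [t' [s'F t'S ->]]].
  have [<-{s' s'F}|ss' _] := eqVneq s s'.
    move=> tt'; rewrite -imsetI; last by move=> x y _ _; apply: GI.
    rewrite card_imset; last exact: GI.
    have /forall_inP/(_ t' t'S)/implyP := sep t tS;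
      rewrite /sdim ltrD2r ltz_nat; apply.
    by apply: contraNneq tt' => ->.
  rewrite ltnNge; apply/negP; set w := _ :&: _ => pw.
  have w0 : w != set0 by rewrite -card_gt0 (leq_trans p0).
  have [t1 t1t E] := sub_imset (subsetIl _ _ : w \subset G s @: t).
  have t1L : t1 \in L.
    apply: (simplicialE sL (subsetP SL _ tS)) => //.
    by move: w0; rewrite E imset_eq0.
  have pt1 : p <= #|t1| by rewrite -(card_imset _ (GI s sF)) -E.
  have := far s s' t1 sF s'F ss' t1L pt1; rewrite -E => /negP; apply.
  apply: (simplicialE (sfull s') (inK s' t' s'F (subsetP SL _ t'S))) => //.
  exact: subsetIr.
- apply/subsetP => u /imP[s [t [sF tL ->]]].
  exact: (subsetP (iterSdS d (fullK s sF))) (inK s t sF tL).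
move=> k pk; rewrite -cardsX.
have -> : faces (im L) k = im (faces L k).
  apply/setP => u; rewrite inE; apply/andP/imP.
    move=> [/imP[s [t [sF tL ->]]]]; rewrite card_imset; last exact: GI.
    by move=> tk; exists s, t; split=> //; rewrite inE tL.
  move=> [s [t [sF tk ->]]]; rewrite card_imset; last exact: GI.
  by move: tk; rewrite inE => /andP[tL ->]; split=> //; apply/imP; exists s, t.
apply: card_in_imset => -[s t] [s' t'] /setXP[/= sF tk] /setXP[/= s'F tk'] /= E.
move: tk tk'; rewrite !inE => /andP[tL /eqP tk] /andP[tL' _].
have [ss'|ss'] := eqVneq s s'.
  by move: E; rewrite -ss' => /(imset_inj (GI s sF)) ->.
have := far s s' t sF s'F ss' tL; rewrite tk E inK // => H.
by have := H pk.
Qed.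
End Copies.

End Functoriality.

(** * Passage to the limit *)

Lemma fvec_top_gt0 (T : finType) (K : {set {set T}}) n : height K = n.+1 ->
  (0 < fvec K n)%N.
Proof.
move=> hK; rewrite card_gt0; apply/eqP => F0.
suff : (height K <= n)%N by rewrite hK ltnn.
apply: height_le => s sK; rewrite leqNgt; apply/negP => ns.
have : s \in faces K n.+1 by rewrite inE sK eqn_leq ns -hK leq_height.
by rewrite F0 inE.
Qed.

Section TotalLimits.
Local Open Scope classical_set_scope.
Variable R : realType.

(** The limit of a divergent sequence is 0 by convention, so that an upper bound
    of a nonnegative sequence passes to its limit even if it diverges. *)
Lemma limn_le_of_ge0 (u v : nat -> R) (l : R) : (forall d, 0 <= u d) ->
  v @ \oo --> l -> (\forall d \near \oo, u d <= v d) -> limn u <= l.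
Proof.
move=> u0 vl uv; rewrite -(cvg_lim (@Rhausdorff R) vl).
have cv : cvgn v by apply/cvg_ex; exists l.
have [cu|/dvgP ->] := pselect (cvgn u); first exact: ler_lim.
apply: limr_ge => //; near=> d; apply: le_trans (u0 d) _; near: d; exact: uv.
Unshelve. all: by end_near.
Qed.

(** The recursion of face numbers under subdivision has diagonal coefficients
    [(k + 1)!], and only the last of them reaches the normalising factor. *)
Lemma fvec_limit (n : nat) : exists l : nat -> R,
  forall (T : finType) (K : {set {set T}}), simplicial K -> height K = n.+1 ->
  forall k, (k <= n)%N ->
   (fun d => (fvec (iterSd K d) k)%:R / ((fvec K n)%:R * (n.+1)`!%:R ^+ d) : R)
     @ \oo --> l k.
Proof.
have n0 : (n.+1)`!%:R != 0 :> R by rewrite pnatr_eq0 -lt0n fact_gt0.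
have [] := @cvg_triangular R n
  (fun k j => (flag_count k j.+1)%:R / (n.+1)`!%:R).
- by move=> k j /andP[jk kn]; rewrite flag_count_small ?mul0r.
- by rewrite flag_count_diag divff.
- move=> k kn; rewrite flag_count_diag divr_ge0 ?ler0n //= ltr_pdivrMr ?mul1r
  ?ltr0n ?fact_gt0 //.
  by rewrite ltr_nat ltn_fact.
move=> l Hl; exists l => T K sK hK.
have fn := fvec_top_gt0 hK.
apply: (Hl (fun k d => _)).
  by rewrite expr0 mulr1 divff // pnatr_eq0 -lt0n.
move=> k d kn /=; rewrite (fvec_Sd_sum _ (simplicial_iterSd sK d) (m := n.+1));
  last first.
  by rewrite -hK height_iterSd.
rewrite natr_sum mulr_suml; apply: eq_bigr => j _; rewrite natrM exprS.
have fnR : (fvec K n)%:R != 0 :> R by rewrite pnatr_eq0 -lt0n.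
by field; rewrite n0 fnR expf_neq0.
Qed.
End TotalLimits.

Lemma dimc_height (T : finType) (K : {set {set T}}) n : dimc K = n%:Z ->
  height K = n.+1.
Proof. by rewrite /dimc; lia. Qed.

Lemma heightS (T : finType) (K L : {set {set T}}) : K \subset L ->
  (height K <= height L)%N.
Proof. by move=> /subsetP KL; apply: height_le => s /KL; apply: leq_height. Qed.

Lemma height_Delta n : (height (Delta n) <= n.+1)%N.
Proof. by apply: height_le => s _; apply: leq_trans (max_card _) _;
  rewrite card_ord. Qed.

Lemma setT_Delta n : [set: 'I_n.+1] \in Delta n.
Proof. by rewrite inE; apply/set0Pn; exists ord0; rewrite inE. Qed.

Lemma height_DeltaE n : height (Delta n) = n.+1.
Proof.
apply/eqP; rewrite eqn_leq height_Delta /=.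
by have := leq_height (setT_Delta n); rewrite cardsT card_ord.
Qed.

Lemma fvec_Delta n : fvec (Delta n) n = 1%N.
Proof.
rewrite /fvec (_ : faces _ _ = [set [set: 'I_n.+1]]) ?cards1 //.
apply/setP => t; rewrite inE in_set1; apply/andP/eqP => [[_ /eqP tn]|->].
  by apply/eqP; rewrite eqEcard subsetT cardsT card_ord tn leqnn.
by rewrite setT_Delta cardsT card_ord.
Qed.

Lemma fvec_top (T : finType) (K : {set {set T}}) n d : simplicial K ->
  (height K <= n.+1)%N ->
  fvec (iterSd K d) n = (fvec K n * (n.+1)`! ^ d)%N.
Proof.
move=> sK hK; elim: d => [|d IH]; first by rewrite muln1.
rewrite /= (fvec_Sd_sum _ (simplicial_iterSd sK d)
  (leq_trans (height_iterSd sK d) hK)).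
rewrite (bigD1 ord_max) //= flag_count_diag IH big1 ?addn0;
  first by rewrite expnS mulnCA.
move=> j jn; rewrite flag_count_small ?mul0n //.
by have := ltn_ord j; move: jn; rewrite -(inj_eq val_inj) /=; lia.
Qed.

Lemma packings_packed n p d (L : {set {set (SdT 'I_n.+1 d)}}) : L \in packings
  n p d ->
  exists S, packed p L S.
Proof.
rewrite inE => /and3P[sL _ /existsP[S
  /and4P[SL /forall_inP cover /forall_inP sep _]]].
exists S; split => // [t tL|s s' sS sS' ss']; first exact/exists_inP/cover.
by have /forall_inP/(_ s' sS') := sep s sS; rewrite ss' /sdim ltrD2r ltz_nat.
Qed.

Lemma set0_packings n p d : set0 \in packings n p d.
Proof.
rewrite inE sub0set; apply/and3P; split=> //.
  by apply/andP; split; [rewrite inE|apply/forall_inP => s; rewrite inE].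
apply/existsP; exists set0; rewrite sub0set /=.
by apply/and3P; split; apply/forall_inP => s; rewrite inE.
Qed.

Section Bound.
Variables (R : realType) (nu : R) (p n : nat).
Hypotheses (nu01 : 0 <= nu <= 1) (p0 : (0 < p)%N) (pn : (p < n)%N).

Let c : R := nu * (1 - nu) * (nu ^+ p + (1 - nu) ^+ p).

Lemma coef_ge0 : 0 <= c.
Proof.
have n2 : 0 <= 1 - nu by rewrite subr_ge0; case/andP: nu01.
case/andP: nu01 => n0 _; exact: mulr_ge0 (mulr_ge0 n0 n2)
  (addr_ge0 (exprn_ge0 _ n0) (exprn_ge0 _ n2)).
Qed.

Definition alt_fvec (T : finType) (K : {set {set T}}) : R :=
  \sum_(p.+1 <= l < n.+1) (-1) ^+ (l.+1 - p) * (fvec K l)%:R.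

(** The error of the bound below; it does not grow under subdivision. *)
Definition betti_const (T : finType) (K : {set {set T}}) : R :=
  (cbetti 'F_2 p.+2 K)%:R + 2 * (cbetti 'F_2 p.+1 K)%:R +
  c * \sum_(p.+1 <= l < n.+1) (cbetti 'F_2 l.+1 K)%:R.

Lemma betti_const_iterSd (T : finType) (K : {set {set T}}) d : simplicial K ->
  betti_const (iterSd K d) <= betti_const K.
Proof.
move=> sK; have H k : (0 < k)%N -> (cbetti 'F_2 k (iterSd K d))%:R <=
  (cbetti 'F_2 k K)%:R :> R.
  by move=> k0; rewrite ler_nat cbetti_iterSd // char2_F2.
rewrite /betti_const lerD ?lerD ?ler_wpM2l ?coef_ge0 ?H //.
by apply: ler_sum => l _; apply: H.
Qed.

Lemma rank_le_alt (T : finType) (K : {set {set T}}) : simplicial K ->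
  (height K <= n.+1)%N ->
  (\dim (boundaries 'F_2 p.+1 K))%:R <=
  alt_fvec K + \sum_(p.+1 <= l < n.+1) (cbetti 'F_2 l.+1 K)%:R.
Proof.
move=> sK hK; rewrite (rank_alternating R sK _ hK); last by rewrite ltnS ltnW.
rewrite /alt_fvec -big_split /= !big_nat; apply: ler_sum => l /andP[pl _].
rewrite betti_cbetti //; last by lia.
rewrite mulrBr lerD2l; apply: le_trans (ler_norm _) _.
by rewrite normrN normrM normrX normrN1 expr1n mul1r ger0_norm ?ler0n.
Qed.

Lemma expected_betti_packing (T : finType) (K : {set {set T}}) d
    (L : {set {set (SdT 'I_n.+1 d)}}) :
  simplicial K -> (height K <= n.+1)%N -> L \in packings n p d ->
  expected_betti nu p (iterSd K d) <=
    betti_const K + c * alt_fvec (iterSd K d) - (fvec K n)%:R * M_ p nu L.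
Proof.
move=> sK hK LP; have [S pL] := packings_packed LP.
have [W [P [pW WX cardW]]] := packed_copies sK p0 LP.
have sX := simplicial_iterSd sK d; have hX := leq_trans (height_iterSd sK d) hK.
have [sW _ _ _] := pW.
have pn1 : (p < n.+1)%N by rewrite ltnS ltnW.
have hL : (height L <= n.+1)%N.
  move: LP; rewrite inE => /and3P[_ /heightS hL _]; apply: leq_trans hL _.
  exact: leq_trans (height_iterSd (simplicial_Delta n) d) (height_Delta n).
have rW : (\dim (boundaries 'F_2 p.+1 W))%:R = (fvec K n)%:R *
  (\dim (boundaries 'F_2 p.+1 L))%:R :> R.
  rewrite (packed_rank R p0 pW pn1 (leq_trans (heightS WX) hX))
    (packed_rank R p0 pL pn1 hL).
  rewrite mulr_sumr !big_nat; apply: eq_bigr => i /andP[pi _].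
  rewrite /fvec cardW; last by lia.
  by rewrite natrM mulrCA.
have := expected_betti_le sX nu01 p0 sW WX
  (fun U => packed_acyclic char2_F2 pW U (ltnSn p))
    (packed_cbetti char2_F2 pW (ltnSn p)).
rewrite -/c rW (packed_M nu p0 pL) -/c => H.
have := betti_const_iterSd d sK; have := ler_wpM2l coef_ge0 (rank_le_alt sX hX).
move: H; rewrite /betti_const.
set x := _%:R * _; set y := \dim (boundaries _ _ (iterSd K d)).
rewrite mulrCA -/x mulrBr mulrDr; lra.
Qed.

Lemma expected_betti_iterated (T : finType) (K : {set {set T}}) d e
    (L : {set {set (SdT 'I_n.+1 d)}}) :
  simplicial K -> (height K <= n.+1)%N -> L \in packings n p d ->
  expected_betti nu p (iterSd K (d + e)) <=
    betti_const K + c * alt_fvec (iterSd K (d + e))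
    - (fvec K n)%:R * (n.+1)`!%:R ^+ e * M_ p nu L.
Proof.
move=> sK hK LP.
apply: (@iterSd_iterSd (fun T' X => expected_betti nu p X <=
  betti_const K + c * alt_fvec X - (fvec K n)%:R * (n.+1)`!%:R ^+ e * M_ p nu
    L)).
apply: le_trans (expected_betti_packing (simplicial_iterSd sK e)
  (leq_trans (height_iterSd sK e) hK) LP) _.
by rewrite fvec_top // natrM natrX lerD2r lerD2r betti_const_iterSd.
Qed.

Lemma M_packing_ge0 d (L : {set {set (SdT 'I_n.+1 d)}}) : L \in packings n p d
  ->
  0 <= M_ p nu L.
Proof.
by move=> /packings_packed[S pL];
  rewrite (packed_M nu p0 pL) mulr_ge0 ?ler0n ?coef_ge0.
Qed.

Lemma expected_betti_ge0 (T : finType) (K : {set {set T}}) : 0 <=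
  expected_betti nu p K.
Proof. by apply: sumr_ge0 => eps _; rewrite mulr_ge0 ?prob_ge0. Qed.
End Bound.

Section NormalizedLimits.
Local Open Scope classical_set_scope.
Variables (R : realType) (n : nat) (T : finType) (K : {set {set T}}).
Hypotheses (sK : simplicial K) (hK : height K = n.+1).

Let N (d : nat) : R := (fvec K n)%:R * (n.+1)`!%:R ^+ d.

(** The limit of face numbers defining [q_] is taken on a simplex, but it is the
    same for every complex of dimension [n]. *)
Lemma fvec_cvg_q k : (k <= n)%N ->
  (fun d => (fvec (iterSd K d) k)%:R / N d) @ \oo --> q_ R k n.
Proof.
move=> kn; have [l Hl] := fvec_limit R n.
suff -> : q_ R k n = l k by apply: Hl.
apply: cvg_lim; first exact: Rhausdorff.
have := Hl _ _ (simplicial_Delta n) (height_DeltaE n) k kn; rewrite fvec_Delta.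
by under [X in X @ _ --> _ -> _]eq_fun => d do rewrite mul1r.
Qed.

Lemma alt_fvec_cvg p :
  (fun d => alt_fvec R p n (iterSd K d) / N d) @ \oo -->
  \sum_(p.+1 <= l < n.+1) (-1) ^+ (l.+1 - p) * q_ R l n.
Proof.
rewrite big_nat.
have -> : (fun d => alt_fvec R p n (iterSd K d) / N d) = (fun d =>
    \sum_(p.+1 <= l < n.+1 | (p.+1 <= l < n.+1)%N)
       (-1) ^+ (l.+1 - p) * ((fvec (iterSd K d) l)%:R / N d)).
  apply/funext => d; rewrite /alt_fvec mulr_suml big_nat.
  by apply: eq_bigr => l _; rewrite mulrA.
by apply: cvg_sumr => l /andP[_ ln]; apply: cvgMr; apply: fvec_cvg_q.
Qed.

Lemma normalized_cst_cvg0 (b : R) : (0 < n)%N -> (fun d => b / N d) @ \oo -->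
  (0 : R).
Proof.
move=> n0; have -> : (fun d => b / N d) =
    (fun d => b / (fvec K n)%:R * ((n.+1)`!%:R^-1) ^+ d).
  by apply/funext => d; rewrite /N invfM mulrA exprVn.
rewrite -(mulr0 (b / (fvec K n)%:R)); apply: cvgMr.
apply: cvg_expr; rewrite ger0_norm ?invr_ge0 ?ler0n //.
rewrite invf_lt1 ?ltr0n ?fact_gt0 // ltr1n.
by apply: leq_trans (fact_geq n.+1).
Qed.

Lemma normalized_bound_cvg (b c m : R) p : (0 < n)%N ->
  (fun d => b / N d + c * (alt_fvec R p n (iterSd K d) / N d) - m) @ \oo -->
  c * (\sum_(p.+1 <= l < n.+1) (-1) ^+ (l.+1 - p) * q_ R l n) - m.
Proof.
move=> n0; apply: cvgB; last exact: cvg_cst.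
rewrite -[c * _]add0r; apply: cvgD; first exact: normalized_cst_cvg0.
by apply: cvgMr; apply: alt_fvec_cvg.
Qed.
End NormalizedLimits.

Theorem theorem1p7 (R : realType) (n : nat) (nu : R) (p : nat)
    (T : finType) (K : {set {set T}})
    (n_gt0 : (0 < n)%N) (nu01 : 0 <= nu <= 1) (p_bounds : (1 <= p <= n - 1)%N)
    (K_complex : simplicial K) (dimK : dimc K = n%:Z) :
  e_ p nu n K <=
    nu * (1 - nu) * (nu ^+ p + (1 - nu) ^+ p) *
      (\sum_(p.+1 <= l < n.+1) (-1) ^+ (l.+1 - p) * q_ R l n)
    - lambda_ p nu n.
Proof.
have /andP[p0 pn'] := p_bounds; have pn : (p < n)%N by lia.
set c := nu * _ * _; set s := \sum_(_ <= _ < _) _.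
have hK := dimc_height dimK.
pose N d : R := (fvec K n)%:R * (n.+1)`!%:R ^+ d.
have fn0 : (fvec K n)%:R != 0 :> R by rewrite pnatr_eq0 -lt0n fvec_top_gt0.
have q0 : (n.+1)`!%:R != 0 :> R by rewrite pnatr_eq0 -lt0n fact_gt0.
have N0 d : 0 < N d.
  by rewrite /N mulr_gt0 ?exprn_gt0 ?ltr0n ?fact_gt0 ?fvec_top_gt0.
(* the bound with a single packing L in place of the limit lambda *)
have e_le d0 L : L \in packings n p d0 ->
    e_ p nu n K <= c * s - M_ p nu L / (n.+1)`!%:R ^+ d0.
  move=> LP.
  have cvgN := @normalized_bound_cvg R n T K K_complex hK
    (betti_const nu p n K) c
    (M_ p nu L / (n.+1)`!%:R ^+ d0) p n_gt0.
  apply: (limn_le_of_ge0 _ cvgN).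
    by move=> d; apply: divr_ge0; [exact: expected_betti_ge0|exact: ltW (N0 d)].
  exists d0 => // d /= d0d.
  have := expected_betti_iterated nu01 p0 pn (d - d0) K_complex (eq_leq hK) LP.
  rewrite subnKC // => H; rewrite -/(N d) ler_pdivrMr //; apply: le_trans H _.
  have -> : N d = (fvec K n)%:R * (n.+1)`!%:R ^+ (d - d0) * (n.+1)`!%:R ^+ d0.
    by rewrite -mulrA -exprD subnK.
  rewrite -/c le_eqVlt; apply/orP; left; apply/eqP; field.
  by rewrite fn0 !expf_neq0.
have lambda_d_le d0 : lambda_d p nu n d0 <= c * s - e_ p nu n K.
  have qd : 0 < (n.+1)`!%:R ^+ d0 :> R by rewrite exprn_gt0 ?ltr0n ?fact_gt0.
  have M_le L : L \in packings n p d0 ->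
      M_ p nu L <= (c * s - e_ p nu n K) * (n.+1)`!%:R ^+ d0.
    by move=> LP; rewrite -ler_pdivrMr // lerBrDl -lerBrDr e_le.
  by rewrite /lambda_d ler_pdivrMr //; apply: bigmax_le => //;
     apply: M_le; exact: set0_packings.
rewrite lerBrDl -lerBrDr.
apply: (limn_le_of_ge0 (v := fun=> c * s - e_ p nu n K)); last exact: nearW.
  move=> d; rewrite divr_ge0 ?exprn_ge0 //.
  apply: le_trans (M_packing_ge0 nu01 p0 (set0_packings n p d)) _.
  exact: bigmax_ge_id.
exact: cvg_cst.
Qed.
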